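(* Let $X$ be an arbitrary complex Banach space and let $A$ be the generator of an analytic semigroup on $X$. Suppose that $A(\lambda-A)^{-1}$ is uniformly bounded for $\lambda\in\Sigma_\vartheta$ with an angle $\vartheta>\pi/2$. Consider an $s$-stage Runge--Kutta method of order at least $1$ with coefficients $Q=(a_{ij})_{i,j=1}^s$, $b=(b_i)_{i=1}^s$, $c=(c_i)_{i=1}^s$, that is A-stable, has an invertible coefficient matrix $Q$ and satisfies $|R(\infty)|<1$. Then the numerical solution with stepsize $\tau>0$ defined by $u_0=0$ and, for $n\ge0$, $$U_{ni}=u_n+\tau\sum_{j=1}^s a_{ij}\dot U_{nj},\qquad u_{n+1}=u_n+\tau\sum_{i=1}^s b_i\dot U_{ni},\qquad \dot U_{ni}=AU_{ni}+f(t_n+c_i\tau)\qquad(i=1,\dots,s),$$ is bounded by $$\|(Au_{n+1})_{n=0}^{N-1}\|_{\ell^p(X)}+\|(AU_n)_{n=0}^{N-1}\|_{\ell^p(X^s)}\le C\,\log N\,\|(F_n)_{n=0}^{N-1}\|_{\ell^p(X^s)},$$ where the constant $C$ is independent of $N$ and $\tau$ and $1\le p\le\infty$. Here $U_n=(U_{ni})_{i=1}^s\in X^s$, $AU_n=(AU_{ni})_{i=1}^s$ and $F_n=(f(t_n+c_i\tau))_{i=1}^s\in X^s$.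
   Context: $\Sigma_\vartheta=\{z\in\mathbb C\setminus\{0\}:|\arg z|<\vartheta\}$ and $t_n=n\tau$; $f$ is an $X$-valued function. The stability function of the Runge--Kutta method is $R(z)=1+z\,b^T(I-zQ)^{-1}\mathbf 1$ with $\mathbf 1=(1,\dots,1)^T\in\mathbb R^s$; for invertible $Q$, $R(\infty)=1-b^TQ^{-1}\mathbf 1$. The method is A-stable if $I-zQ$ is nonsingular and $|R(z)|\le1$ for all complex $z$ with $\mathrm{Re}\,z\le0$. The $U_{ni}\in X$ are the internal stages; $\dot U_{ni}\in X$ is notation for the increments (not a derivative). $X^s$ carries any fixed product norm. For a finite sequence $(v_n)$ in a Banach space $Y$, $\|(v_n)\|_{\ell^p(Y)}=\big(\sum_n\|v_n\|_Y^p\big)^{1/p}$ for $p<\infty$ and $\max_n\|v_n\|_Y$ for $p=\infty$.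
   Formalization: The bound is stated for N ≥ 2 only; for N = 1 the factor log N is 0 and the printed inequality fails (e.g. implicit Euler with X = ℂ, A = −1, f = 1 has Au_1 ≠ 0). *)

(* Defs.v *)
From HB Require Import structures.
From mathcomp Require Import all_boot all_order all_algebra.
From mathcomp Require Import complex.
From mathcomp Require Import all_classical all_reals all_analysis.
Import numFieldNormedType.Exports.
Import Order.TTheory GRing.Theory Num.Theory.

Set Implicit Arguments.
Unset Strict Implicit.
Unset Printing Implicit Defensive.

Local Open Scope classical_set_scope.
Local Open Scope ring_scope.
Local Open Scope complex_scope.

(* The norm of a [normedModType R[i]] takes its values in [R[i]] (on the
   nonnegative real axis); [normR] is the same norm with values in [R]. *)
Definition normR (R : realType) (X : normedModType R[i]) (x : X) : R :=
  complex.Re `|x|.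

(* [arg] takes its values in ]-pi, pi], so this is C \ {0} when theta > pi. *)
Definition sector (R : realType) (theta : R) : set R[i] :=
  [set z | exists r phi : R,
    [/\ 0 < r, `|phi| < theta & z = (r * cos phi) +i* (r * sin phi)]].

Definition bounded_operator (R : realType) (X : normedModType R[i])
    (B : X -> X) : Prop :=
  linear B /\ exists M : R, forall x : X, normR (B x) <= M * normR x.

(* Analytic C_0-semigroup of angle delta: T is only relevant on the sector and
   at 0. Holomorphy is required of the orbits z |-> T z x, which is the same as
   holomorphy in operator norm by the uniform boundedness principle. *)
Definition analytic_semigroup (R : realType) (X : completeNormedModType R[i])
    (delta : R) (T : R[i] -> X -> X) : Prop :=
  [/\ 0 < delta <= pi / 2,
      forall x : X, T 0 x = x,
      forall z, sector delta z -> bounded_operator (T z)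
    & [/\ forall z w, sector delta z -> sector delta w ->
            forall x, T (z + w) x = T z (T w x),
          forall (x : X) (z : R[i]^o), sector delta z ->
            derivable (fun w : R[i]^o => T w x) z 1
        & forall (x : X) (delta' : R), 0 < delta' < delta ->
            T z x @[z --> within (sector delta') (nbhs (0 : R[i]^o))] --> x]].

(* An unbounded operator is given by its domain D and a total function A whose
   values outside D are irrelevant. *)
Definition generator (R : realType) (X : completeNormedModType R[i])
    (T : R[i] -> X -> X) (D : set X) (A : X -> X) : Prop :=
  let quotient (x : X) (t : R) : X := (t^-1)%:C *: (T t%:C x - x) in
  (forall x, D x <-> exists y : X, quotient x t @[t --> 0^'+] --> y) /\
  (forall x, D x -> quotient x t @[t --> 0^'+] --> A x).

Definition generates_analytic_semigroup (R : realType)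
    (X : completeNormedModType R[i]) (D : set X) (A : X -> X) : Prop :=
  exists (delta : R) (T : R[i] -> X -> X),
    analytic_semigroup delta T /\ generator T D A.

Definition is_resolvent (R : realType) (X : completeNormedModType R[i])
    (D : set X) (A : X -> X) (lambda : R[i]) (B : X -> X) : Prop :=
  [/\ bounded_operator B,
      forall x, D (B x) /\ lambda *: B x - A (B x) = x
    & forall x, D x -> B (lambda *: x - A x) = x].

(* The sector belongs to the resolvent set, and A (lambda - A)^-1 is bounded
   uniformly in lambda. *)
Definition uniformly_sectorial (R : realType) (X : completeNormedModType R[i])
    (D : set X) (A : X -> X) (theta : R) : Prop :=
  exists M : R, forall lambda, sector theta lambda ->
    exists B : X -> X, is_resolvent D A lambda B /\
      forall x, normR (A (B x)) <= M * normR x.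

(* C^k in terms of directional derivatives. *)
Fixpoint of_class_C (R : realType) (V W : normedModType R) (k : nat)
    (g : V -> W) : Prop :=
  if k is k'.+1 then
    forall v : V, (forall x, derivable g x v) /\
                  of_class_C k' (fun x => 'D_v g x)
  else continuous g.

(* Order at least p: for every smooth system y' = g(t, y) in R^d the local error
   after one step of size h is O(h^(p+1)). The stage equations are implicit; for
   small h they have a unique solution near y(t0), which is the one meant. *)
Definition rk_order_ge (R : realType) (s : nat) (Q : 'M[R]_s) (b c : 'cV[R]_s)
    (p : nat) : Prop :=
  forall (d : nat) (g : R * 'rV[R]_d -> 'rV[R]_d) (t0 : R) (y : R -> 'rV[R]_d)
    (Y : R -> 'I_s -> 'rV[R]_d),
  (forall k, of_class_C k g) ->
  (\forall t \near t0, is_derive t (1 : R) y (g (t, y t))) ->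
  (forall i, Y h i @[h --> 0^'+] --> y t0) ->
  (\forall h \near 0^'+, forall i,
     Y h i = y t0 + h *: \sum_(j < s) Q i j *: g (t0 + c j 0 * h, Y h j)) ->
  exists K : R, \forall h \near 0^'+,
    `| y t0 + h *: (\sum_(i < s) b i 0 *: g (t0 + c i 0 * h, Y h i))
       - y (t0 + h) | <= K * h ^+ p.+1.

Definition stage_matrix (R : realType) (s : nat) (Q : 'M[R]_s) (z : R[i]) :
    'M[R[i]]_s :=
  1%:M - z *: map_mx (real_complex R) Q.

Definition stability_fun (R : realType) (s : nat) (Q : 'M[R]_s) (b : 'cV[R]_s)
    (z : R[i]) : R[i] :=
  1 + z * ((map_mx (real_complex R) b)^T *m invmx (stage_matrix Q z)
             *m (const_mx 1 : 'cV_s)) 0 0.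

Definition stability_infty (R : realType) (s : nat) (Q : 'M[R]_s)
    (b : 'cV[R]_s) : R :=
  1 - (b^T *m invmx Q *m (const_mx 1 : 'cV_s)) 0 0.

Definition A_stable (R : realType) (s : nat) (Q : 'M[R]_s) (b : 'cV[R]_s) :
    Prop :=
  forall z : R[i], complex.Re z <= 0 ->
    stage_matrix Q z \in unitmx /\ `|stability_fun Q b z| <= 1.

Record rk_trajectory (X : Type) (s : nat) := RKTrajectory {
  rk_val : nat -> X;
  rk_stage : nat -> 'I_s -> X;
  rk_incr : nat -> 'I_s -> X
}.

Definition rk_node (R : realType) (s : nat) (c : 'cV[R]_s) (tau : R) (n : nat)
    (i : 'I_s) : R :=
  n%:R * tau + c i 0 * tau.

Definition rk_solution (R : realType) (X : completeNormedModType R[i])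
    (D : set X) (A : X -> X) (s : nat) (Q : 'M[R]_s) (b c : 'cV[R]_s)
    (tau : R) (f : R -> X) (w : rk_trajectory X s) : Prop :=
  let: RKTrajectory u U dU := w in
  u 0%N = 0 /\
  forall n : nat,
    [/\ forall i, D (U n i),
        forall i, U n i = u n + tau%:C *: \sum_(j < s) (Q i j)%:C *: dU n j,
        u n.+1 = u n + tau%:C *: \sum_(i < s) (b i 0)%:C *: dU n i
      & forall i, dU n i = A (U n i) + f (rk_node c tau n i)].

(* Any norm on X^s inducing the product topology. *)
Definition product_norm (R : realType) (X : normedModType R[i]) (s : nat)
    (nu : ('I_s -> X) -> R) : Prop :=
  [/\ forall V W, nu (fun i => V i + W i) <= nu V + nu W,
      forall (z : R[i]) V, nu (fun i => z *: V i) = complex.Re `|z| * nu V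
    & exists m M : R, [/\ 0 < m, 0 < M & forall V,
        m * \big[Num.max/0]_(i < s) normR (V i) <= nu V
          <= M * \big[Num.max/0]_(i < s) normR (V i)]].

(* l^p norm of (v 0, ..., v (N-1)) in Y, whose norm is nY; meant for p >= 1. *)
Definition lp_norm (R : realType) (Y : Type) (nY : Y -> R) (p : \bar R)
    (N : nat) (v : nat -> Y) : R :=
  match p with
  | r%:E => (\sum_(n < N) nY (v n) `^ r) `^ r^-1
  | +oo%E => \big[Num.max/0]_(n < N) nY (v n)
  | -oo%E => 0
  end.

(* Main.v *)
(** Put [J = (1 - tau A)^-1]. The sectoriality of [A] says that, for [Re z > 0],
    [|z| |J v| <= K |(z - tau A) J v|] with [K] independent of [tau]; rational
    functions of [tau A] are quotients of polynomials in [J].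

    Write the stability function as [R = P / q]. For [|zeta| < 1] the roots [z_i]
    of [q - zeta P] lie in the open right half plane by A-stability and stay
    bounded since [|R(oo)| < 1]. The product of the [|z_i|] is comparable to
    [|1 - zeta|], and since [R'(0) = 1] some product of all but one of them is
    bounded below. Replacing one linear factor of [q(tau A)] at a time by a factor
    of [(q - zeta P)(tau A)] gives, with [T = R(tau A)] and
    [V = - tau A (1 - tau A)^-1],
      [|1 - zeta| |x| <= C |x - zeta T x|] and [|V x| <= C |x - zeta T x|].

    These bounds imply [|V T^n| <= K / (n + 1)]. Instead of a Cauchy integral of
    [(1 - zeta T)^-3], truncated binomial sums are averaged over the N-th roots of
    unity on a circle of radius [rho < 1]; the average of [|1 - zeta|^-2] is
    [O(1 / (1 - rho))].

    By variation of constants [A u_n] and [A U_n] are dominated by the discrete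
    convolution of the norms of [F_k] with the kernel [1 / (n - k + 1)], whose
    [l^1] norm on [0, N) is [O(log N)]; Schur's test gives the [l^p] bound. *)

Require Import Defs.
From HB Require Import structures.
From mathcomp Require Import all_boot all_order all_algebra.
From mathcomp Require Import complex.
From mathcomp Require Import all_classical all_reals all_analysis.
From mathcomp Require Import ring lra zify.
Import numFieldNormedType.Exports.
Import Order.TTheory GRing.Theory Num.Theory.
Local Open Scope classical_set_scope.
Local Open Scope ring_scope.
Local Open Scope complex_scope.

Set Implicit Arguments.
Unset Strict Implicit.
Unset Printing Implicit Defensive.

(** * Moduli, norms and roots of unity *)

Section Modulus.
Variable R : realType.
Implicit Types z w : R[i].

Definition modC z : R := complex.Re `|z|.

Lemma modCE z : `|z| = (modC z)%:C.
Proof. by rewrite /modC normc_def. Qed.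

Lemma modC_ge0 z : 0 <= modC z.
Proof. by rewrite -lecR -modCE normr_ge0. Qed.

Lemma modC0 : modC 0 = 0.
Proof. by apply: complexI; rewrite -modCE normr0. Qed.

Lemma modC1 : modC 1 = 1.
Proof. by apply: complexI; rewrite -modCE normr1. Qed.

Lemma modC_eq0 z : (modC z == 0) = (z == 0).
Proof. by rewrite -(normr_eq0 z) modCE -(inj_eq (@complexI R)). Qed.

Lemma modC_gt0 z : (0 < modC z) = (z != 0).
Proof. by rewrite lt_def modC_ge0 andbT modC_eq0. Qed.

Lemma modCM z w : modC (z * w) = modC z * modC w.
Proof. by apply: complexI; rewrite rmorphM /= -!modCE normrM. Qed.

Lemma modCV z : modC z^-1 = (modC z)^-1.
Proof. by apply: complexI; rewrite fmorphV /= -!modCE normfV. Qed.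

Lemma modCX z n : modC (z ^+ n) = modC z ^+ n.
Proof. by elim: n => [|n IH]; rewrite ?expr0 ?modC1// !exprS modCM IH. Qed.

Lemma modCN z : modC (- z) = modC z.
Proof. by rewrite /modC normrN. Qed.

Lemma modCD z w : modC (z + w) <= modC z + modC w.
Proof. by rewrite -lecR rmorphD /= -!modCE ler_normD. Qed.

Lemma modC_sum n (F : 'I_n -> R[i]) : modC (\sum_i F i) <= \sum_i modC (F i).
Proof.
elim/big_rec2: _ => [|i y x _ h]; first by rewrite modC0.
by apply: le_trans (modCD _ _) _; rewrite lerD2l.
Qed.

Lemma modCR (x : R) : modC x%:C = `|x|.
Proof. by rewrite /modC normc_def /= expr0n addr0 sqrtr_sqr. Qed.

Lemma modC_nat n : modC n%:R = n%:R.
Proof. by rewrite -(rmorph_nat (real_complex R)) modCR ger0_norm. Qed.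

Lemma real_complexV (x : R) : (x^-1)%:C = (x%:C)^-1.
Proof. exact: fmorphV. Qed.

End Modulus.

Section NormR.
Variables (R : realType) (X : normedModType R[i]).
Implicit Types x y : X.
Local Notation "`[ x ]" := (normR x) (format "`[ x ]").

Lemma normRE x : `|x| = (normR x)%:C.
Proof.
rewrite /normR; have: 0 <= `|x| by [].
by case: (`|x|) => a b; rewrite lecE /= => /andP[/eqP-> _].
Qed.

Lemma normR_ge0 x : 0 <= normR x.
Proof. by rewrite -lecR -normRE normr_ge0. Qed.

Lemma normR0 : normR (0 : X) = 0.
Proof. by apply: complexI; rewrite -normRE normr0. Qed.

Lemma normR_eq0 x : normR x = 0 -> x = 0.
Proof. by move=> h; apply/eqP; rewrite -normr_eq0 normRE h. Qed.

Lemma normRZ (z : R[i]) x : normR (z *: x) = modC z * normR x.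
Proof. by apply: complexI; rewrite rmorphM /= -normRE -modCE -normRE normrZ. Qed.

Lemma normRN x : normR (- x) = normR x.
Proof. by rewrite /normR normrN. Qed.

Lemma normRD x y : normR (x + y) <= normR x + normR y.
Proof. by rewrite -lecR rmorphD /= -!normRE ler_normD. Qed.

Lemma normRB x y : normR (x - y) <= normR x + normR y.
Proof. by rewrite -(normRN y) normRD. Qed.

Lemma normR_sum (I : Type) (r : seq I) (P : pred I) (F : I -> X) :
  normR (\sum_(i <- r | P i) F i) <= \sum_(i <- r | P i) normR (F i).
Proof.
elim/big_rec2: _ => [|i y x _ h]; first by rewrite normR0.
by apply: le_trans (normRD _ _) _; rewrite lerD2l.
Qed.

End NormR.

(** ['X^n - 1] splits and is separable in characteristic zero, and a finite group of roots of unity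
    is cyclic. *)
Lemma prim_root_exists (F : numClosedFieldType) (n : nat) :
  (0 < n)%N -> exists z : F, n.-primitive_root z.
Proof.
move=> n_gt0; pose p : {poly F} := 'X^n - 1.
have [r Dp] := closed_field_poly_normal p.
have sz_p : size p = n.+1 by rewrite size_XnsubC.
rewrite (monicP _) ?monicXnsubC // scale1r in Dp.
have rn1 : all n.-unity_root r by apply/allP=> z; rewrite -root_prod_XsubC -Dp.
have sz_r : (n < (size r).+1)%N by rewrite -(size_prod_XsubC r id) -Dp sz_p.
have [|z] := hasP (cyclic.has_prim_root n_gt0 rn1 _ sz_r); last by exists z.
by rewrite -separable.separable_prod_XsubC -Dp cyclotomic.separable_Xn_sub_1 // pnatr_eq0 -lt0n.
Qed.

Section RootAverages.
Variables (R : realType) (N : nat) (w : R[i]).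
Hypotheses (N_gt0 : (0 < N)%N) (prim : N.-primitive_root w).

(** Orthogonality of characters: for [k != n] the ratio [t] is an N-th root of unity other than 1,
    so its geometric sum vanishes. *)
Lemma sum_root_powers (k n : nat) : (k < N)%N -> (n < N)%N ->
  \sum_(j < N) (w ^+ j) ^- n * (w ^+ j) ^+ k = (if k == n then N%:R else 0).
Proof.
move=> kN nN; have w0 : w != 0.
  by rewrite (prim_root_eq0 prim) -lt0n.
under eq_bigr do rewrite -exprM mulnC exprM -exprVn -exprM mulnC exprM -exprMn.
set t := _ * _; case: eqP => [kn|/eqP kn].
  rewrite /t kn mulVf ?expf_neq0//.
  by under eq_bigr do rewrite expr1n; rewrite sumr_const card_ord.
have tN : t ^+ N = 1.
  by rewrite exprMn exprVn -!exprM ![(_ * N)%N]mulnC !exprM (prim_expr_order prim) !expr1n invr1 mulr1.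
have t1 : t - 1 != 0.
  rewrite subr_eq0; apply: contra kn => /eqP t1.
  have : w ^+ k == w ^+ n.
    by rewrite -[w ^+ n]mulr1 -t1 /t mulrA mulfV ?mul1r ?expf_neq0.
  by rewrite (eq_prim_root_expr prim) /eqn !modn_small.
by apply: (mulfI t1); rewrite mulr0 -subrX1 tN subrr.
Qed.

Lemma modC_prim_root (j : nat) : modC (w ^+ j) = 1.
Proof.
rewrite modCX; suff -> : modC w = 1 by rewrite expr1n.
apply/eqP; rewrite -(@pexpr_eq1 _ _ N) ?modC_ge0// -modCX.
by rewrite (prim_expr_order prim) modC1.
Qed.

(* (1 - rho^2) / |1 - z|^2 = 2 Re (1 / (1 - z)) - 1 when |z| = rho, and the
   geometric series averages to [1 / (1 - rho^N)] over the circle. *)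
Lemma sum_inv_dist_sqr (rho : R) : 0 < rho < 1 -> rho ^+ N <= 2^-1 ->
  \sum_(j < N) (modC (1 - rho%:C * w ^+ j)) ^- 2 <= N%:R * 3 / (1 - rho).
Proof.
move=> /andP[r0 r1] rN.
pose z (j : 'I_N) := rho%:C * w ^+ j.
have mz j : modC (z j) = rho by rewrite /z modCM modC_prim_root mulr1 modCR gtr0_norm.
have z1 j : 1 - z j != 0.
  rewrite subr_eq0; apply/eqP => h; have := mz j; rewrite -h modC1 => h1.
  by move: r1; rewrite -h1 ltxx.
have rho2 : 1 - rho ^+ 2 != 0 by rewrite gt_eqF// subr_gt0 expr_lt1// ltW.
have rhoN : 1 - rho ^+ N != 0.
  by rewrite gt_eqF// subr_gt0; apply: le_lt_trans rN _; rewrite invf_lt1// ltr1n.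
have geo : \sum_j (1 - z j)^-1 = N%:R / (1 - rho ^+ N)%:C.
  have rhoNC : (1 - rho ^+ N)%:C != 0 :> R[i].
    by rewrite -(inj_eq (@complexI R)) in rhoN.
  have e j : (1 - z j)^-1 = (1 - rho ^+ N)%:C^-1 * \sum_(k < N) rho%:C ^+ k * ((w ^+ j) ^- 0 * (w ^+ j) ^+ k).
    apply: (mulfI (z1 j)); rewrite mulfV// mulrCA.
    under eq_bigr do rewrite expr0 invr1 mul1r -exprMn.
    have := subrX1 (z j) N; rewrite -[LHS]opprB -[z j - 1]opprB mulNr => /oppr_inj <-.
    by rewrite /z exprMn -exprM mulnC exprM (prim_expr_order prim) expr1n mulr1
       rmorphB rmorph1 rmorphXn /= mulVf// -rmorphXn -(rmorph1 (real_complex R)) -rmorphB.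
  under eq_bigr do rewrite e.
  rewrite -mulr_sumr exchange_big /=.
  under eq_bigr do rewrite -mulr_sumr sum_root_powers//.
  rewrite (bigD1 (Ordinal N_gt0))//= big1 ?addr0 ?expr0 ?mul1r 1?mulrC//.
  by move=> i /negbTE; rewrite -val_eqE /= => ->; rewrite mulr0.
have poisson j : ((1 - rho ^+ 2) * modC (1 - z j) ^- 2)%:C
    = (1 - z j)^-1 + ((1 - z j)^-1)^*%C - 1.
  have zz : z j * (z j)^*%C = (rho ^+ 2)%:C by rewrite -sqr_normc modCE mz rmorphXn.
  have z1' : 1 - (z j)^*%C != 0.
    by rewrite -conjc1 -rmorphB conjc_eq0.
  have cj : (1 - z j)^*%C = 1 - (z j)^*%C by rewrite rmorphB rmorph1.
  have nz : (modC (1 - z j) ^+ 2)%:C = (1 - z j) * (1 - (z j)^*%C).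
    by rewrite rmorphXn /= -modCE sqr_normc cj.
  rewrite rmorphM fmorphV /= nz conjc_inv cj rmorphB rmorph1 /= -zz.
  field; by rewrite z1 z1'.
have tot : ((1 - rho ^+ 2) * \sum_j modC (1 - z j) ^- 2) = N%:R * (2 / (1 - rho ^+ N) - 1).
  apply: complexI; rewrite mulr_sumr rmorph_sum /=.
  under eq_bigr do rewrite poisson.
  rewrite !big_split /= -rmorph_sum /= geo sumr_const card_ord.
  have -> : N%:R / (1 - rho ^+ N)%:C = (N%:R / (1 - rho ^+ N))%:C :> R[i].
    by rewrite rmorphM fmorphV rmorph_nat.
  rewrite conjc_real -(rmorphN1 (real_complex R)) -rmorphMn -!rmorphD /=.
  congr (_%:C); rewrite -mulr_natl; field.
  exact: rhoN.
have -> : \sum_(j < N) modC (1 - rho%:C * w ^+ j) ^- 2 = (N%:R * (2 / (1 - rho ^+ N) - 1)) / (1 - rho ^+ 2).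
  by apply: (mulfI rho2); rewrite tot mulrCA mulfV// mulr1.
(* [rho ^+ N <= 1/2] caps the averaged Poisson kernel at 3, and [1 - rho^2 >= 1 - rho]. *)
have h4 : 2 / (1 - rho ^+ N) <= 4 by rewrite ler_pdivrMr; lra.
have h5 : 0 <= 2 / (1 - rho ^+ N) - 1.
  rewrite subr_ge0 ler_pdivlMr; last by lra.
  have : 0 <= rho ^+ N by rewrite exprn_ge0// ltW.
  lra.
rewrite -!mulrA ler_wpM2l//; apply: ler_pM => //; first by rewrite invr_ge0 subr_ge0 expr_le1// ltW.
  by rewrite lerBlDr; apply: le_trans h4 _; lra.
have ? : rho ^+ 2 <= rho by rewrite expr2 ger_pMr// ltW.
by rewrite lef_pV2 ?posrE; lra.
Qed.

End RootAverages.

(** * Cauchy estimates *)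

Section BinomialSums.
Variables (R : realType) (X : normedModType R[i]).
Implicit Types (T V : {linear X -> X}) (x : X).

(** The power series of [(1 - T)^-(d+1)], truncated after [N] terms. *)
Definition binsum T d N x : X := \sum_(k < N) 'C(k + d, d)%:R *: iter k T x.

Lemma binsum0 T N x : binsum T 0 N x - T (binsum T 0 N x) = x - iter N T x.
Proof.
rewrite /binsum; elim: N => [|N IH].
  by rewrite !big_ord0 linear0 subr0 /= subrr.
rewrite !big_ord_recr /= addn0 bin0 scale1r linearD opprD addrACA IH.
by rewrite addrA subrK.
Qed.

(** Pascal's rule makes the sum telescope; truncation leaves one boundary term. *)
Lemma binsumS T d N x :
  binsum T d.+1 N x - T (binsum T d.+1 N x)
  = binsum T d N x - 'C(N + d, d.+1)%:R *: iter N T x.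
Proof.
rewrite /binsum; elim: N => [|N IH].
  by rewrite !big_ord0 linear0 add0n bin_small// scale0r.
rewrite !big_ord_recr /= linearD opprD addrACA IH linearZ /=.
rewrite addnS addSn binS natrD !scalerDl.
rewrite linearD /= !linearZ /= scalerN -!addrA; congr (_ + _).
by rewrite addKr.
Qed.

Lemma iter_scale T (z : R[i]) n x : iter n (z \*: T) x = z ^+ n *: iter n T x.
Proof.
elim: n => [|n IH] /=; first by rewrite scale1r.
by rewrite IH linearZ scalerA exprS.
Qed.

Lemma normR_iter T (M : R) n x : 0 <= M ->
  (forall y, normR (T y) <= M * normR y) -> normR (iter n T x) <= M ^+ n * normR x.
Proof.
move=> M0 TM; elim: n => [|n IH] /=; first by rewrite mul1r.
by apply: le_trans (TM _) _; rewrite exprS -mulrA ler_wpM2l.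
Qed.

(* [(1 - z T)^3] times the truncated series of [(1 - z T)^-3] is a small
   perturbation of the identity. *)
Lemma resolvent_cube_bound T V (C C' rho : R) (N : nat) (z : R[i]) x :
  1 <= C -> 0 <= C' -> 0 < rho < 1 -> modC z = rho ->
  (forall x, modC (1 - z) * normR x <= C * normR (x - z *: T x)) ->
  (forall x, normR (V x) <= C' * normR (x - z *: T x)) ->
  N.+1%:R ^+ 2 * rho ^+ N * normR (iter N T x) <= normR x / 4 ->
  normR (V (binsum (z \*: T) 2 N x))
    <= 3 * C ^+ 2 * C' * normR x * modC (1 - z) ^- 2.
Proof.
move=> C1 C'0 /andP[r0 r1] zr h1 h2 hN.
set Y := z \*: T; set S := fun d => binsum Y d N x; set D := modC (1 - z).
have D0 : 0 < D.
  rewrite modC_gt0 subr_eq0; apply/eqP => h; move: r1.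
  by rewrite -zr -h modC1 ltxx.
have D2 : D <= 2.
  by apply: le_trans (modCD _ _) _; rewrite modC1 modCN zr; lra.
have x0 := normR_ge0 x.
(* The boundary terms for [d = 0, 1, 2] carry the coefficients 1, [N] and [C(N+1, 2)], all at most
   [(N+1)^2]. *)
have tail (c : nat) : (c <= N.+1 ^ 2)%N -> normR (c%:R *: iter N Y x) <= normR x / 4.
  move=> cN; apply: le_trans hN; rewrite iter_scale scalerA normRZ modCM modC_nat modCX zr.
  by rewrite ler_wpM2r ?normR_ge0// ler_wpM2r ?exprn_ge0 ?(ltW r0)// -natrX ler_nat.
(* Three inversions of [1 - z T]: the first two cost [C / |1 - z|] each, the last is taken under [V]
   and costs only [C']. What remains is [|1 - z|^-2], whose average over the circle is under
   control. *)
have a0 : D * normR (S 0%N) <= C * (normR x * (5 / 4)).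
  apply: le_trans (h1 _) _; rewrite ler_wpM2l ?(le_trans ler01)//.
  have -> : S 0%N - z *: T (S 0%N) = x - iter N Y x by rewrite -(binsum0 Y).
  apply: le_trans (normRB _ _) _.
  by have := tail 1%N; rewrite scale1r => /(_ isT); lra.
have a1 : D * normR (S 1%N) <= C * (normR (S 0%N) + normR x / 4).
  apply: le_trans (h1 _) _; rewrite ler_wpM2l ?(le_trans ler01)//.
  have -> : S 1%N - z *: T (S 1%N) = S 0%N - 'C(N + 0, 1)%:R *: iter N Y x.
    by rewrite -(binsumS Y).
  apply: le_trans (normRB _ _) _; rewrite lerD2l tail// addn0 bin1.
  by rewrite (leq_trans (leqnSn _))// -[X in (X <= _)%N]expn1 leq_pexp2l.
have a2 : normR (V (S 2%N)) <= C' * (normR (S 1%N) + normR x / 4).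
  apply: le_trans (h2 _) _; rewrite ler_wpM2l//.
  have -> : S 2%N - z *: T (S 2%N) = S 1%N - 'C(N + 1, 2)%:R *: iter N Y x.
    by rewrite -(binsumS Y).
  apply: le_trans (normRB _ _) _; rewrite lerD2l tail// addn1 bin2.
  by rewrite /= expnS expn1 -divn2 (leq_trans (leq_div _ _))// leq_mul.
apply: le_trans a2 _.
rewrite [X in _ <= X](_ : _ = C' * (3 * C ^+ 2 * normR x * D ^- 2)); last first.
  by rewrite /D; ring.
rewrite ler_wpM2l// ler_pdivlMr ?exprn_gt0//.
have s0 := normR_ge0 (S 0%N); have s1 := normR_ge0 (S 1%N).
have b1 : D ^+ 2 * normR (S 1%N) <= C * (C * (normR x * (5 / 4)) + normR x / 2).
  rewrite expr2 -mulrA; apply: le_trans (_ : D * (C * (normR (S 0%N) + normR x / 4)) <= _).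
    by rewrite ler_wpM2l// ltW.
  rewrite mulrCA ler_wpM2l ?(le_trans ler01)// mulrDr lerD//.
  have : D * (normR x / 4) <= 2 * (normR x / 4) by rewrite ler_wpM2r// divr_ge0.
  lra.
have b2 : D ^+ 2 * (normR x / 4) <= normR x.
  have : D ^+ 2 <= 2 ^+ 2 by rewrite lerXn2r// nnegrE// ltW.
  by move=> h; have := ler_wpM2r x0 h; lra.
rewrite mulrC mulrDr; apply: le_trans (lerD b1 b2) _.
have c1 : normR x <= C * normR x by rewrite ler_peMl.
have c2 : C * normR x <= C ^+ 2 * normR x.
  by rewrite expr2 -mulrA ler_wpM2l// (le_trans ler01).
rewrite mulrDr !mulrA -expr2; lra.
Qed.

(** Averaging against [(w ^+ j) ^- n] extracts the n-th term of the truncated cube series exactly,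
    all its exponents being below [N]. The coefficient [C(n+2, 2)] of that term is at least
    [(n+1)^2 / 2]. *)
Lemma cauchy_estimate T V (C C' rho : R) (N n : nat) x :
  1 <= C -> 0 <= C' -> 0 < rho < 1 -> rho ^+ N <= 2^-1 -> (n < N)%N ->
  (forall z x, modC z = rho -> modC (1 - z) * normR x <= C * normR (x - z *: T x)) ->
  (forall z x, modC z = rho -> normR (V x) <= C' * normR (x - z *: T x)) ->
  N.+1%:R ^+ 2 * rho ^+ N * normR (iter N T x) <= normR x / 4 ->
  n.+1%:R ^+ 2 * rho ^+ n * normR (V (iter n T x))
    <= 18 * C ^+ 2 * C' / (1 - rho) * normR x.
Proof.
move=> C1 C'0 r01 rN nN h1 h2 hN.
have /andP[r0 r1] := r01.
have N0 : (0 < N)%N by case: N nN {rN hN}.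
have [w prim] := @prim_root_exists R[i] N N0.
pose z (j : 'I_N) := rho%:C * w ^+ j.
have zr j : modC (z j) = rho.
  by rewrite modCM (modC_prim_root N0 prim) mulr1 modCR gtr0_norm.
have key : (N%:R * 'C(n + 2, 2)%:R * rho%:C ^+ n) *: V (iter n T x)
  = \sum_(j < N) (w ^+ j) ^- n *: V (binsum (z j \*: T) 2 N x).
  transitivity (\sum_(k < N) ('C(k + 2, 2)%:R * rho%:C ^+ k *
      \sum_(j < N) (w ^+ j) ^- n * (w ^+ j) ^+ k) *: V (iter k T x)).
    rewrite [RHS](bigD1 (Ordinal nN))//= [X in _ = _ + X]big1 ?addr0; last first.
      move=> i; rewrite -val_eqE /= => /negbTE ni.
      by rewrite (sum_root_powers N0 prim)// ni mulr0 scale0r.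
    by congr (_ *: _); rewrite (sum_root_powers N0 prim nN nN) eqxx; ring.
  under eq_bigr do rewrite mulr_sumr scaler_suml.
  rewrite exchange_big; apply: eq_bigr => j _.
  rewrite /binsum linear_sum scaler_sumr; apply: eq_bigr => k _.
  rewrite iter_scale scalerA linearZ /= !scalerA; congr (_ *: _).
  by rewrite exprMn; ring.
have bnd : N%:R * 'C(n + 2, 2)%:R * rho ^+ n * normR (V (iter n T x))
   <= 3 * C ^+ 2 * C' * normR x * (N%:R * 3 / (1 - rho)).
  have -> : N%:R * 'C(n + 2, 2)%:R * rho ^+ n * normR (V (iter n T x))
     = normR ((N%:R * 'C(n + 2, 2)%:R * rho%:C ^+ n) *: V (iter n T x)).
    by rewrite normRZ !modCM !modC_nat modCX modCR gtr0_norm.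
  rewrite key; apply: le_trans (normR_sum _ _ _) _.
  apply: le_trans (_ : 3 * C ^+ 2 * C' * normR x *
     \sum_(j < N) modC (1 - z j) ^- 2 <= _); last first.
    rewrite ler_wpM2l ?(sum_inv_dist_sqr N0 prim)//.
    by rewrite !mulr_ge0 ?normR_ge0//; lra.
  rewrite mulr_sumr; apply: ler_sum => j _.
  rewrite normRZ modCV modCX (modC_prim_root N0 prim) expr1n invr1 mul1r.
  by apply: (@resolvent_cube_bound T V C C' rho) => // *; [exact: h1|exact: h2].
have NR : 0 < N%:R :> R by rewrite ltr0n.
have bin : n.+1%:R ^+ 2 <= 2 * 'C(n + 2, 2)%:R :> R.
  rewrite -natrX -natrM ler_nat mulnC addn2 -[2%N]/(2`!) bin_ffact.
  by rewrite ffactnS /= ffactn1 expnS expn1 leq_mul.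
rewrite -(ler_pM2l NR).
apply: le_trans (_ : 2 * (N%:R * 'C(n + 2, 2)%:R * rho ^+ n * normR (V (iter n T x))) <= _).
  have p0 : 0 <= N%:R * (rho ^+ n * normR (V (iter n T x))).
    by rewrite !mulr_ge0 ?normR_ge0 ?exprn_ge0// ltW.
  by have := ler_wpM2r p0 bin; congr (_ <= _); ring.
have := ler_wpM2l (ler0n R 2) bnd; congr (_ <= _); ring.
Qed.

End BinomialSums.

(** With [m = 32 a] this reads [(a m + 1)^2 2^-m <= 1/4], which makes the truncation terms small
    enough. The number 32 is [4 * 8]: the bound follows from the fourth power of [8 a < 2^(8 a)]. *)
Lemma leq_sqr_exp2 (a : nat) : (0 < a)%N ->
  (4 * (a * (32 * a)).+1 ^ 2 <= 2 ^ (32 * a))%N.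
Proof.
move=> a0; have h : ((8 * a).+1 ^ 4 <= 2 ^ (32 * a))%N.
  rewrite (_ : 32 * a = 8 * a * 4)%N; last by lia.
  by rewrite expnM leq_exp2r// ltn_expl.
apply: leq_trans h; rewrite -[4%N]/(2 * 2)%N expnM -[X in (X * _)%N]/(2 ^ 2)%N -expnMn leq_exp2r//.
by rewrite !expnS !expn0; nia.
Qed.

Lemma leq_sqr_succ_mul (m n : nat) : (0 < m)%N -> (0 < n)%N ->
  (m.+1 ^ 2 * n <= (m * n).+1 ^ 2)%N.
Proof. by case: m n => // m [// | n] _ _; rewrite !expnS !expn0; nia. Qed.

(** * Ritt's theorem: from resolvent bounds to decay of powers *)

Section Ritt.
Variables (R : realType) (X : normedModType R[i]).
Implicit Types (T V : {linear X -> X}) (x : X).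

(** Ritt's condition on the unit disc, stated as a lower bound so that no inverse of [1 - z T]
    appears; [V] takes the place that [1 - T] has in Ritt's theorem. *)
Definition ritt_resolvent (C : R) (T V : X -> X) : Prop :=
  forall (z : R[i]) x, modC z < 1 -> modC (1 - z) * normR x <= C * normR (x - z *: T x)
    /\ normR (V x) <= C * normR (x - z *: T x).

Lemma expRN_gap (a : R) : 0 <= a -> a / (1 + a) <= 1 - expR (- a).
Proof.
move=> a0; rewrite expRN.
have h : (expR a)^-1 <= (1 + a)^-1.
  by rewrite lef_pV2 ?posrE ?expR_gt0 ?expR_ge1Dx//; lra.
have -> : a / (1 + a) = 1 - (1 + a)^-1 by field; lra.
lra.
Qed.

Lemma bernoulli (x : R) n : 0 <= x -> 1 + n%:R * x <= (1 + x) ^+ n.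
Proof.
move=> x0; elim: n => [|n IH]; first by rewrite mul0r addr0.
rewrite exprS; apply: le_trans (ler_wpM2l _ IH); last by lra.
have : 0 <= n%:R * x * x by rewrite !mulr_ge0.
by rewrite -natr1; nra.
Qed.

(* Induction on n: if [|T^(n-1)| <= K] then powers of [T^n] grow at most like
   [(M K)^m], so the Cauchy estimate applies on the circle of radius
   [exp (- (L + 2 M) / n)], and its bound is again [K = exp L] once L is large. *)
Lemma ritt_power_bounded (C M : R) : 1 <= C -> 1 <= M ->
  exists2 K : R, 1 <= K & forall T V, (forall x, normR (T x) <= M * normR x) ->
    ritt_resolvent C T V -> forall n x, normR (iter n T x) <= K * normR x.
Proof.
move=> C1 M1; have M0 : 0 <= M by lra.
have C0 : 0 <= C by lra.
(* Chosen so that the final bound [162 C^3 M^2 expR (L + 2 M) / L^2] collapses to [expR L / L]. *)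
pose L := 162 * C ^+ 3 * M ^+ 2 * expR (2 * M).
have e1 : 1 + 2 * M <= expR (2 * M) by exact: expR_ge1Dx.
have C3 : 1 <= C ^+ 3 by rewrite exprn_ege1.
have M2 : 1 <= M ^+ 2 by rewrite exprn_ege1.
have L1 : expR (2 * M) <= L.
  by rewrite /L ler_peMl ?expR_ge0// -mulrA; nra.
have L2M : 1 + 2 * M <= L by apply: le_trans L1.
have K1 : 1 <= expR L by apply: le_trans (expR_ge1Dx _); lra.
exists (expR L) => // T V TM TR; elim=> [|n IH] x.
  by rewrite /= ler_peMl ?normR_ge0.
have nR : 0 < n.+1%:R :> R by rewrite ltr0n.
(* For small [n] the crude bound [M^(n+1) <= expR (M (n+1))] suffices. *)
have [small|large] := leP (n.+1%:R * M) L.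
  apply: le_trans (normR_iter _ _ M0 TM) _; rewrite ler_wpM2r ?normR_ge0//.
  apply: le_trans (_ : expR M ^+ n.+1 <= _).
    by rewrite lerXn2r ?nnegrE ?expR_ge0//; apply: le_trans (expR_ge1Dx _); lra.
  by rewrite -expRM_natl ler_expR.
pose a := (L + 2 * M) / n.+1%:R; pose rho := expR (- a).
have a0 : 0 < a by rewrite divr_gt0//; lra.
have rhon : rho ^+ n.+1 = expR (- (L + 2 * M)).
  rewrite -expRM_natl mulrN; congr (expR (- _)).
  by rewrite /a mulrC divfK// gt_eqF.
have r0 : 0 < rho by exact: expR_gt0.
have r1 : rho < 1 by rewrite expR_lt1; lra.
(* [N] is a multiple of [n + 1], so [T^N] is a power of [T^(n+1)], which has norm at most [M expR L]
   by induction. On the chosen circle [rho^(n+1) M expR L = M expR (- 2 M) <= 1/2]. *)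
pose m := (32 * n.+1)%N; pose N := (n.+1 * m)%N.
have TnK y : normR (iter n.+1 T y) <= (M * expR L) * normR y.
  by rewrite iterSr -mulrA mulrCA; apply: le_trans (IH _) _; rewrite ler_wpM2l ?expR_ge0.
have TN : rho ^+ N * normR (iter N T x) <= 2^-1 ^+ m * normR x.
  have -> : iter N T x = iter m (iter n.+1 T) x by rewrite /N mulnC iterM.
  have h : normR (iter m (iter n.+1 T) x) <= (M * expR L) ^+ m * normR x.
    elim: (m) x => [|k IHk] y; first by rewrite mul1r.
    rewrite (iterS k); apply: le_trans (TnK _) _; rewrite exprS -[leRHS]mulrA ler_wpM2l//.
    by rewrite mulr_ge0// expR_ge0.
  apply: le_trans (ler_wpM2l (exprn_ge0 _ (ltW r0)) h) _.
  rewrite mulrA ler_wpM2r ?normR_ge0// /N exprM -exprMn rhon.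
  rewrite lerXn2r ?nnegrE ?mulr_ge0 ?expR_ge0//.
  rewrite mulrCA -expRD (_ : - (L + 2 * M) + L = - (2 * M)); last by ring.
  rewrite expRN.
  by rewrite ler_pdivrMr ?expR_gt0//; lra.
have m2 : N.+1%:R ^+ 2 * 2^-1 ^+ m <= 4^-1 :> R.
  rewrite exprVn ler_pdivrMr ?exprn_gt0// ler_pdivlMl// -!natrX -natrM ler_nat.
  exact: leq_sqr_exp2.
have rN : rho ^+ N <= 2^-1.
  apply: le_trans (_ : rho ^+ n.+1 <= _).
    by rewrite /N ler_wiXn2l ?ltW// leq_pmulr.
  by rewrite rhon expRN lef_pV2 ?posrE ?expR_gt0//; apply: le_trans (expR_ge1Dx _); lra.
(* Here [1 + 2 M <= L < (n+1) M], whence [a <= 2 M] and [1 + a <= 3 M]. *)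
have gap : L / (3 * M * n.+1%:R) <= 1 - rho.
  apply: le_trans (expRN_gap (ltW a0)).
  have aM : a <= 2 * M.
    rewrite /a ler_pdivrMr//.
    have : M * L <= M * (n.+1%:R * M) by rewrite ler_wpM2l// ltW.
    by nra.
  have -> : L / (3 * M * n.+1%:R) = (L / n.+1%:R) / (3 * M).
    by field; rewrite ?gt_eqF//; lra.
  apply: ler_pM; [by rewrite divr_ge0//; lra|by rewrite invr_ge0; lra| |].
    by rewrite /a ler_wpM2r ?invr_ge0 ?ltW//; lra.
  by rewrite lef_pV2 ?posrE; lra.
have gap0 : 0 < 1 - rho by rewrite subr_gt0.
have far z : modC z = rho -> 1 - rho <= modC (1 - z).
  by move=> zr; have := modCD (1 - z) z; rewrite subrK modC1 zr; lra.
have ce : n.+2%:R ^+ 2 * rho ^+ n.+1 * normR (iter n.+1 T x)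
    <= 18 * C ^+ 2 * (C / (1 - rho)) / (1 - rho) * normR x.
  (* With the identity for [V] the second constant degrades to [C / (1 - rho)], since
     [|1 - z| >= 1 - rho] on the circle. *)
  apply: (@cauchy_estimate R X T idfun C _ rho N) => //.
  - by rewrite divr_ge0// ltW.
  - by rewrite r0 r1.
  - by rewrite /N ltn_Pmulr// /m (@leq_trans 32)// leq_pmulr.
  - by move=> z y zr; apply: (TR z y _).1; rewrite zr.
  - move=> z y zr; have := (TR z y _).1; rewrite zr => /(_ r1) h.
    rewrite mulrAC ler_pdivlMr//= mulrC; apply: le_trans h.
    by rewrite ler_wpM2r ?normR_ge0// far.
  - rewrite -mulrA; apply: le_trans (ler_wpM2l (sqr_ge0 _) TN) _.
    by rewrite mulrA [leRHS]mulrC ler_wpM2r ?normR_ge0.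
set Y := normR (iter _ _ _) in ce *; have Y0 : 0 <= Y by exact: normR_ge0.
have L0 : 0 < L by lra.
have ginv : (1 - rho)^-1 <= 3 * M * n.+1%:R / L.
  rewrite -[leRHS]invrK lef_pV2 ?posrE//; first by rewrite invf_div.
  by rewrite invr_gt0 divr_gt0// !mulr_gt0//; lra.
have ginv2 : (1 - rho) ^- 2 <= (3 * M * n.+1%:R / L) ^+ 2.
  have g0 : 0 <= (1 - rho)^-1 by rewrite invr_ge0 ltW.
  by rewrite -exprVn lerXn2r ?nnegrE//; apply: le_trans ginv.
have x0 := normR_ge0 x.
have ce2 : n.+1%:R ^+ 2 * (rho ^+ n.+1 * Y) <= n.+1%:R ^+ 2 * (162 * C ^+ 3 * M ^+ 2 / L ^+ 2 * normR x).
  apply: le_trans (_ : n.+2%:R ^+ 2 * (rho ^+ n.+1 * Y) <= _).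
    rewrite ler_wpM2r ?mulr_ge0 ?exprn_ge0 ?(ltW r0)//.
    by rewrite lerXn2r ?nnegrE// ler_nat.
  rewrite mulrA; apply: le_trans ce _.
  rewrite (_ : _ * normR x = (18 * C ^+ 3 * normR x) * (1 - rho) ^- 2); last first.
    by field; rewrite gt_eqF.
  rewrite (_ : n.+1%:R ^+ 2 * _ = (18 * C ^+ 3 * normR x) * (3 * M * n.+1%:R / L) ^+ 2); last first.
    by field; rewrite gt_eqF.
  by rewrite ler_wpM2l// !mulr_ge0// exprn_ge0.
move: ce2; rewrite ler_pM2l ?exprn_gt0// rhon expRN mulrC ler_pdivrMr ?expR_gt0//.
move=> h; apply: le_trans h _.
rewrite mulrAC ler_wpM2r// expRD mulrCA -[leRHS]mulr1 ler_wpM2l ?expR_ge0//.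
rewrite mulrAC -/L.
by rewrite expr2 invfM mulrA mulfV ?gt_eqF// mul1r invf_le1//; lra.
Qed.

(** Once the powers are bounded, the Cauchy estimate applies on the circle of radius [(n+1)/(n+2)]:
    there [1 / (1 - rho) = n + 2] uses up one of the two powers of [n], and
    [rho^(n+1) >= expR (- 1)]. *)
Lemma ritt_estimate (C M : R) : 1 <= C -> 1 <= M ->
  exists2 K : R, 0 <= K & forall T V, (forall x, normR (T x) <= M * normR x) ->
    ritt_resolvent C T V -> forall n x, n.+1%:R * normR (V (iter n T x)) <= K * normR x.
Proof.
move=> C1 M1; have [k k1 pb] := ritt_power_bounded C1 M1.
exists (18 * C ^+ 3 * expR 1); first by rewrite !mulr_ge0 ?expR_ge0//; lra.
move=> T V TM TR n x.
have [K kK] : exists K : nat, k <= K%:R.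
  by exists (Num.bound k); apply/ltW/archi_boundP; lra.
have K0 : (0 < K)%N by rewrite -(ltr0n R); lra.
pose rho : R := n.+1%:R / n.+2%:R.
have r0 : 0 < rho by rewrite divr_gt0 ?ltr0n.
have n1 : 0 < n.+1%:R :> R by rewrite ltr0n.
have n2 : n.+2%:R = n.+1%:R + 1 :> R by rewrite -natr1.
have gap : 1 - rho = n.+2%:R^-1 by rewrite /rho n2; field; lra.
have r1 : rho < 1 by rewrite -subr_gt0 gap invr_gt0 ltr0n.
have rhoV : rho^-1 = 1 + n.+1%:R^-1 by rewrite /rho n2; field; lra.
have half : rho ^+ n.+1 <= 2^-1.
  rewrite -[rho]invrK rhoV exprVn lef_pV2 ?posrE ?exprn_gt0 ?addr_gt0 ?invr_gt0//.
  by apply: le_trans (bernoulli _ _); rewrite ?invr_ge0// mulfV// gt_eqF.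
(* The factor [K] in [a] absorbs the power bound: [(N+1)^2 K <= (N K + 1)^2] and [N K = a m]. *)
pose a := (n.+1 * K)%N; pose m := (32 * a)%N; pose N := (n.+1 * m)%N.
have a0 : (0 < a)%N by rewrite muln_gt0.
have rN' : rho ^+ N <= 2^-1 ^+ m.
  by rewrite /N exprM lerXn2r ?nnegrE ?exprn_ge0// ltW.
have rN : rho ^+ N <= 2^-1.
  apply: le_trans rN' _; rewrite -[leRHS]expr1 ler_wiXn2l//; last by rewrite muln_gt0.
  by rewrite invf_le1// ler1n.
have ce : n.+1%:R ^+ 2 * rho ^+ n * normR (V (iter n T x))
    <= 18 * C ^+ 2 * C / (1 - rho) * normR x.
  apply: (@cauchy_estimate R X T V C _ rho N) => //.
  - lra.
  - by rewrite r0 r1.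
  - by rewrite /N (leq_trans (ltnSn n))// leq_pmulr// muln_gt0.
  - by move=> z y zr; apply: (TR z y _).1; rewrite zr.
  - by move=> z y zr; apply: (TR z y _).2; rewrite zr.
  have : N.+1%:R ^+ 2 * rho ^+ N * normR (iter N T x) <= N.+1%:R ^+ 2 * rho ^+ N * (K%:R * normR x).
    rewrite ler_wpM2l ?mulr_ge0 ?exprn_ge0 ?(ltW r0)//.
    by apply: le_trans (pb _ _ TM TR _ _) _; rewrite ler_wpM2r ?normR_ge0.
  move/le_trans; apply; rewrite mulrA [leRHS]mulrC ler_wpM2r ?normR_ge0//.
  apply: le_trans (_ : (a * m).+1%:R ^+ 2 * 2^-1 ^+ m <= _); last first.
    rewrite exprVn ler_pdivrMr ?exprn_gt0// ler_pdivlMl// -!natrX -natrM ler_nat.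
    exact: leq_sqr_exp2.
  rewrite mulrAC; apply: ler_pM => //; rewrite ?mulr_ge0 ?exprn_ge0 ?(ltW r0)//.
  rewrite -!natrX -natrM ler_nat /a mulnAC -/N.
  by rewrite leq_sqr_succ_mul// /N !muln_gt0.
rewrite gap invrK in ce.
have Y0 := normR_ge0 (V (iter n T x)); have x0 := normR_ge0 x.
set Y := normR (V _) in ce Y0 *.
have ce2 : n.+1%:R * rho ^+ n.+1 * Y <= 18 * C ^+ 3 * normR x.
  have n2p : 0 < n.+2%:R :> R by rewrite ltr0n.
  have rn : n.+2%:R * rho = n.+1%:R by rewrite /rho mulrC divfK// gt_eqF.
  rewrite -(ler_pM2l n2p).
  have -> : n.+2%:R * (n.+1%:R * rho ^+ n.+1 * Y) = n.+1%:R * (n.+2%:R * rho) * rho ^+ n * Y.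
    by rewrite exprS; ring.
  rewrite rn -expr2; move: ce; congr (_ <= _); ring.
have e1 : expR (- 1) <= rho ^+ n.+1.
  rewrite expRN -[rho]invrK exprVn lef_pV2 ?posrE ?expR_gt0 ?exprn_gt0 ?invr_gt0//.
  apply: le_trans (_ : expR n.+1%:R^-1 ^+ n.+1 <= _).
    rewrite lerXn2r ?nnegrE ?expR_ge0 ?invr_ge0 ?(ltW r0)// rhoV; exact: expR_ge1Dx.
  by rewrite -expRM_natl mulfV// gt_eqF.
have : n.+1%:R * Y * expR (- 1) <= 18 * C ^+ 3 * normR x.
  apply: le_trans ce2; rewrite [leRHS]mulrAC ler_wpM2l// mulr_ge0//.
by rewrite expRN ler_pdivrMr ?expR_gt0// mulrAC.
Qed.

End Ritt.

(** * Polynomials acting through a linear map *)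

Section PolyAction.
Variables (F : comNzRingType) (X : lmodType F) (J : {linear X -> X}).
Implicit Types (p q : {poly F}) (x y : X).

Definition act p x : X := \sum_(i < size p) p`_i *: iter i J x.

Lemma act_wide n p x : (size p <= n)%N -> act p x = \sum_(i < n) p`_i *: iter i J x.
Proof.
move=> pn; rewrite /act (big_ord_widen _ (fun i => p`_i *: iter i J x) pn).
rewrite big_mkcond; apply: eq_bigr => i _; case: ltnP => // ip.
by rewrite nth_default// scale0r.
Qed.

Lemma iter_linear n : linear (iter n J).
Proof. by move=> a x y; elim: n => //= n ->; rewrite linearP. Qed.

Lemma act_is_linear p : linear (act p).
Proof.
move=> a x y; rewrite /act scaler_sumr -big_split; apply: eq_bigr => i _ /=.
by rewrite iter_linear scalerDr !scalerA [p`_i * a]mulrC.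
Qed.

HB.instance Definition _ p := GRing.isLinear.Build F X X _ (act p) (act_is_linear p).

Lemma actD p q x : act (p + q) x = act p x + act q x.
Proof.
set n := maxn (size p) (size q).
rewrite (@act_wide n) ?(leq_trans (size_polyD _ _))//.
rewrite (@act_wide n p) ?leq_maxl// (@act_wide n q) ?leq_maxr//.
by rewrite -big_split; apply: eq_bigr => i _; rewrite coefD scalerDl.
Qed.

Lemma actZ a p x : act (a *: p) x = a *: act p x.
Proof.
rewrite (@act_wide (size p)) ?size_scale_leq// scaler_sumr.
by apply: eq_bigr => i _; rewrite coefZ scalerA.
Qed.

Lemma actN p x : act (- p) x = - act p x.
Proof. by rewrite -(scaleN1r p) actZ scaleN1r. Qed.

Lemma actB p q x : act (p - q) x = act p x - act q x.
Proof. by rewrite actD actN. Qed.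

Lemma act1 x : act 1 x = x.
Proof. by rewrite /act size_poly1 big_ord1 coef1 scale1r. Qed.

Lemma act0 x : act 0 x = 0.
Proof. by rewrite /act size_poly0 big_ord0. Qed.

Lemma actC a x : act a%:P x = a *: x.
Proof. by rewrite -[a%:P]mulr1 mul_polyC actZ act1. Qed.

Lemma actMX p x : act (p * 'X) x = act p (J x).
Proof.
rewrite (@act_wide (size p).+1) ?size_polyMleq ?(leq_trans (size_polyMleq _ _)) ?size_polyX ?addn2//.
rewrite big_ord_recl coefMX eqxx scale0r add0r.
by apply: eq_bigr => i _; rewrite coefMX /= -iterSr.
Qed.

Lemma actX x : act 'X x = J x.
Proof. by rewrite -['X]mul1r actMX act1. Qed.

Lemma actM p q x : act (p * q) x = act p (act q x).
Proof.
elim/poly_ind: q x => [|q c IH] x; first by rewrite mulr0 !act0 linear0.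
rewrite mulrDr actD mulrA actMX IH actD actMX actC mulrC mul_polyC actZ.
by rewrite linearD linearZ.
Qed.

Lemma act_comm p q x : act p (act q x) = act q (act p x).
Proof. by rewrite -!actM mulrC. Qed.

Lemma act_sum (I : Type) (r : seq I) (P : pred I) (p : I -> {poly F}) x :
  act (\sum_(i <- r | P i) p i) x = \sum_(i <- r | P i) act (p i) x.
Proof.
elim/big_rec2: _ => [|i y q _ <-]; first by rewrite act0.
by rewrite actD.
Qed.

End PolyAction.

Lemma normR_act (R : realType) (X : normedModType R[i]) (J : {linear X -> X})
    (M : R) p x : 0 <= M -> (forall y, normR (J y) <= M * normR y) ->
  normR (act J p x) <= (\sum_(i < size p) modC p`_i * M ^+ i) * normR x.
Proof.
move=> M0 JM; apply: le_trans (normR_sum _ _ _) _.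
rewrite mulr_suml; apply: ler_sum => i _; rewrite normRZ -mulrA.
by rewrite ler_wpM2l ?modC_ge0// normR_iter.
Qed.

(** * Linear factors and symmetric functions of the roots *)

Section LinearFactors.
Variable R : realType.
Local Notation C := R[i].
Implicit Types (z : C) (s : seq C).

(* With [w = 1 / (1 - z)] this is [(z - A) J] when [J = (1 - A)^-1]; a factor
   with [z = 1] is constant, i.e. corresponds to a root at infinity. *)
Definition lin z : {poly C} := 1 - (1 - z) *: 'X.

Definition prodlin s : {poly C} := \prod_(z <- s) lin z.

Definition prodmod s : R := \prod_(z <- s) modC z.

(** The elementary symmetric function of degree [size s - 1] in the moduli: the sum over i of the
    products of all [|z_j|] with [j != i]. *)
Fixpoint sum_cofactors s : R :=
  if s is z :: s' then prodmod s' + modC z * sum_cofactors s' else 0.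

Lemma prodlin_cons z s : prodlin (z :: s) = lin z * prodlin s.
Proof. by rewrite /prodlin big_cons. Qed.

Lemma prodmod_cons z s : prodmod (z :: s) = modC z * prodmod s.
Proof. by rewrite /prodmod big_cons. Qed.

Lemma prodmod_ge0 s : 0 <= prodmod s.
Proof. by apply: prodr_ge0 => z _; exact: modC_ge0. Qed.

Lemma sum_cofactors_ge0 s : 0 <= sum_cofactors s.
Proof.
by elim: s => //= z s IH; rewrite addr_ge0 ?prodmod_ge0// mulr_ge0 ?modC_ge0.
Qed.

Lemma horner_lin z w : (lin z).[w] = 1 - (1 - z) * w.
Proof. by rewrite /lin !hornerE. Qed.

Lemma lin1 : lin 1 = 1.
Proof. by rewrite /lin subrr scale0r subr0. Qed.

Lemma prodlin_nseq1 n : prodlin (nseq n 1) = 1.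
Proof.
elim: n => [|n IH]; first by rewrite /prodlin big_nil.
by rewrite prodlin_cons IH lin1 mulr1.
Qed.

Lemma act_lin (X : lmodType C) (J : {linear X -> X}) z x :
  act J (lin z) x = x - (1 - z) *: J x.
Proof. by rewrite actB act1 actZ actX. Qed.

Lemma horner_prodlin1 s : modC (prodlin s).[1] = prodmod s.
Proof.
elim: s => [|z s IH]; first by rewrite /prodlin /prodmod !big_nil hornerE modC1.
rewrite prodlin_cons hornerM modCM IH prodmod_cons horner_lin mulr1.
by rewrite opprB addrC subrK.
Qed.

Lemma horner_prodlin0 s : (prodlin s).[0] = 1.
Proof.
elim: s => [|z s IH]; first by rewrite /prodlin big_nil hornerE.
by rewrite prodlin_cons hornerM IH horner_lin mulr0 subr0 mulr1.
Qed.

(** Product rule: at 1 the factor [lin z] has the value [z] and the derivative [- (1 - z)], of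
    modulus at most [1 + B]. *)
Lemma deriv_prodlin1 (B : R) s : (forall z, z \in s -> modC z <= B) ->
  modC (prodlin s)^`().[1] <= (1 + B) * sum_cofactors s.
Proof.
elim: s => [|z s IH] sB.
  by rewrite /prodlin big_nil derivC hornerE modC0 mulr0.
have zB : modC z <= B by apply: sB; rewrite mem_head.
have B0 : 0 <= B := le_trans (modC_ge0 _) zB.
rewrite prodlin_cons derivM hornerD !hornerM /= mulrDr.
apply: le_trans (modCD _ _) _; rewrite !modCM horner_prodlin1; apply: lerD.
  rewrite ler_wpM2r ?prodmod_ge0// /lin derivB derivC derivZ derivX !hornerE modCN.
  by apply: le_trans (modCD _ _) _; rewrite modC1 modCN lerD2l.
rewrite horner_lin mulr1 opprB addrC subrK mulrCA ler_wpM2l ?modC_ge0//.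
by apply: IH => y ys; apply: sB; rewrite inE ys orbT.
Qed.

Lemma prodmod_le_cofactors (B : R) s : s != [::] ->
  (forall z, z \in s -> modC z <= B) -> prodmod s <= B * sum_cofactors s.
Proof.
case: s => // z s _ sB; have zB : modC z <= B by apply: sB; rewrite mem_head.
have B0 : 0 <= B := le_trans (modC_ge0 _) zB.
rewrite prodmod_cons /=; apply: le_trans (_ : B * prodmod s <= _).
  by rewrite ler_wpM2r ?prodmod_ge0.
by rewrite ler_wpM2l// lerDl mulr_ge0 ?modC_ge0 ?sum_cofactors_ge0.
Qed.

(** A root [r] of [p], nonzero because [p.[0] != 0], gives the factor [lin (1 - r^-1)]. Padding with
    [z = 1], that is with roots at infinity, makes the length independent of the degree of [p]. *)
Lemma lin_factorization (n : nat) (p : {poly C}) :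
  p.[0] != 0 -> (size p <= n.+1)%N ->
  exists2 s, size s = n & p = p.[0] *: prodlin s.
Proof.
move=> p0 pn; have [r Dp] := closed_field_poly_normal p.
have pN0 : p != 0 by apply: contra p0 => /eqP->; rewrite horner0.
have lc0 : lead_coef p != 0 by rewrite lead_coef_eq0.
have sr : (size r <= n)%N.
  by rewrite -ltnS -(size_prod_XsubC r id) -(size_scale _ lc0) -Dp.
have r0 z : z \in r -> z != 0.
  move=> zr; apply: contra p0 => /eqP z0; rewrite z0 in zr.
  by rewrite Dp hornerZ mulf_eq0; apply/orP; right; rewrite -[_ == 0]/(root _ _) root_prod_XsubC.
have fac r' : {subset r' <= r} ->
    exists a, \prod_(z <- r') ('X - z%:P) = a *: prodlin [seq 1 - z^-1 | z <- r'].
  elim: r' => [|z r' IH] sub; first by exists 1; rewrite /prodlin !big_nil scale1r.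
  have [|a ea] := IH; first by move=> y yr; apply: sub; rewrite inE yr orbT.
  have z0 : z != 0 by apply: r0; apply: sub; rewrite mem_head.
  exists (- z * a); rewrite big_cons ea map_cons prodlin_cons -scalerAr -scalerA.
  rewrite [RHS]scalerA [_ * a]mulrC -scalerA; congr (_ *: _).
  rewrite scalerAl; congr (_ * _).
  rewrite /lin subKr scalerBr scalerA mulNr mulfV// scaleN1r opprK.
  by rewrite -[- z *: 1]mul_polyC mulr1 polyCN addrC.
have [a ea] := fac r (fun _ h => h).
exists ([seq 1 - z^-1 | z <- r] ++ nseq (n - size r) 1).
  by rewrite size_cat size_map size_nseq subnKC.
set s := _ ++ _; suff [b eb] : exists b, p = b *: prodlin s.
  by rewrite {1 2}eb hornerZ horner_prodlin0 mulr1.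
exists (lead_coef p * a).
by rewrite {1}Dp ea scalerA /s /prodlin big_cat /= -![\prod_(z <- _) _]/(prodlin _) prodlin_nseq1 mulr1.
Qed.

End LinearFactors.

(** * Roots of the stability pencil *)

Section StabilityPencil.
Variable R : realType.
Local Notation C := R[i].

(* [D w = w^s det (I - z Q)] and [N / D] is the stability function, in the
   variable [w = 1 / (1 - z)]: [w = 0] is [z] at infinity, [w = 1] is [z = 0]. *)
Record stability_pencil (D N : {poly C}) : Prop := StabilityPencil {
  pencil_at_infinity : modC N.[0] < modC D.[0];
  pencil_den_one : D.[1] = 1;
  pencil_num_one : N.[1] = 1;
  pencil_consistent : (N - D)^`().[1] = 1;
  pencil_A_stable : forall w zeta : C, w != 0 -> complex.Re (1 - w^-1) <= 0 ->
    modC zeta < 1 -> (D - zeta *: N).[w] != 0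
}.

(* The roots [z_i] lie in the open right half plane by A-stability, are bounded
   because [|R(oo)| < 1], and since [R'(0) = 1] at most one of them can be small:
   this is the bound from below on [sum_cofactors]. *)
Lemma pencil_factorization D N : stability_pencil D N ->
  exists n (B c : R), [/\ 0 < c, 0 <= B &
    forall zeta, modC zeta < 1 -> exists s c0,
    [/\ size s = n, D - zeta *: N = c0 *: prodlin s,
        c <= modC c0 <= B, modC c0 * prodmod s = modC (1 - zeta) &
        (forall z, z \in s -> 0 < complex.Re z /\ modC z <= B) /\ c <= sum_cofactors s]].
Proof.
move=> [Hinf HD HN Hc HA].
pose n := maxn (size D) (size N).
pose S := \sum_(i < n.+1) (modC D`_i.+1 + modC N`_i.+1).
pose d := modC D.[0] - modC N.[0].
have d0 : 0 < d by rewrite subr_gt0.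
have S0 : 0 <= S by apply: sumr_ge0 => i _; rewrite addr_ge0 ?modC_ge0.
pose B := 2 + S / d + 2 * modC D.[0].
have B2 : 2 + S / d <= B by rewrite /B lerDl mulr_ge0 ?modC_ge0.
have Sd0 : 0 <= S / d by rewrite divr_ge0// ltW.
have D0 := modC_ge0 D.[0].
have B0 : 0 <= B by lra.
pose K := 2 * modC D.[0] * ((1 + modC D^`().[1]) * B + (1 + B)).
have D'0 := modC_ge0 D^`().[1].
have D'1 : 0 <= 1 + modC D^`().[1] by lra.
have K0 : 0 <= K by apply: mulr_ge0; [lra|have := mulr_ge0 D'1 B0; lra].
pose c := Num.min d (1 + K)^-1.
have c0 : 0 < c by rewrite lt_min d0 invr_gt0; lra.
(* Length [n.+1] makes the list of roots visibly nonempty, as [prodmod_le_cofactors] requires. *)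
exists n.+1, B, c; split => // zeta zeta1.
pose p := D - zeta *: N.
have p0E : p.[0] = D.[0] - zeta * N.[0] by rewrite !hornerE.
have p0_ge : d <= modC p.[0].
  have : modC D.[0] <= modC p.[0] + modC (zeta * N.[0]).
    by apply: le_trans (modCD _ _); rewrite p0E subrK.
  rewrite modCM => h; have : modC zeta * modC N.[0] <= modC N.[0].
    by rewrite ler_piMl ?modC_ge0// ltW.
  by rewrite /d; lra.
have p0_le : modC p.[0] <= 2 * modC D.[0].
  rewrite p0E; apply: le_trans (modCD _ _) _; rewrite modCN modCM.
  have : modC zeta * modC N.[0] <= modC N.[0].
    by rewrite ler_piMl ?modC_ge0// ltW.
  by lra.
have p0 : p.[0] != 0 by rewrite -modC_gt0; lra.
have sp : (size p <= n.+2)%N.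
  rewrite (leq_trans (size_polyD _ _))// geq_max size_polyN.
  rewrite (leq_trans _ (leqnSn _)) ?(leq_trans _ (leqnSn _)) ?leq_maxl//=.
  by rewrite (leq_trans (size_scale_leq _ _))// leq_maxr.
have [s ss ps] := lin_factorization p0 sp.
exists s, p.[0]; split=> //.
- by rewrite (le_trans _ p0_ge) ?ge_min ?lexx//= (le_trans p0_le)// /B; lra.
- rewrite -horner_prodlin1 -modCM -hornerZ -ps.
  by rewrite /p !hornerE HD HN mulr1.
have roots z : z \in s -> 1 - z != 0 -> p.[(1 - z)^-1] = 0.
  move=> zs z1; rewrite ps hornerZ /prodlin (big_rem z zs) /= hornerM horner_lin.
  by rewrite mulfV// subrr mul0r mulr0.
have sB z : z \in s -> 0 < complex.Re z /\ modC z <= B.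
  move=> zs; have [z1|z1] := eqVneq (1 - z) 0.
    have -> : z = 1 by apply/eqP; rewrite eq_sym -subr_eq0 z1.
    by rewrite modC1 ltr01; split=> //; lra.
  have rz := roots z zs z1; have w0 : (1 - z)^-1 != 0 by rewrite invr_eq0.
  split.
    rewrite ltNge; apply/negP => h; have := HA _ zeta w0.
    by rewrite invrK opprB addrC subrK rz eqxx => /(_ h zeta1).
  set w := (1 - z)^-1 in rz w0.
  (* A root [w] of [p] stays away from 0: if [|w| < 1], the terms of positive degree sum to at most
     [|w| S], yet must cancel [|p.[0]| >= d]. Hence [z = 1 - w^-1] is bounded. *)
  have wB : (modC w)^-1 <= 1 + S / d.
    have [w1|w1] := leP 1 (modC w).
      by apply: le_trans (_ : 1 <= _); [rewrite invf_le1// (lt_le_trans ltr01)|lra].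
    have : modC p.[0] <= modC w * S.
      move: rz; rewrite (@horner_coef_wide _ n.+2)// big_ord_recl expr0 mulr1.
      rewrite -horner_coef0 => /eqP; rewrite addr_eq0 => /eqP ->; rewrite modCN.
      apply: le_trans (modC_sum _) _; rewrite mulr_sumr; apply: ler_sum => i _.
      rewrite modCM modCX /= exprS mulrCA ler_wpM2l ?modC_ge0//.
      rewrite -[leRHS]mulr1; apply: ler_pM; rewrite ?modC_ge0 ?exprn_ge0 ?modC_ge0//.
        rewrite coefB coefZ; apply: le_trans (modCD _ _) _; rewrite modCN modCM lerD2l.
        by rewrite ler_piMl ?modC_ge0// ltW.
      by rewrite exprn_ile1 ?modC_ge0// ltW.
    have w_gt0 : 0 < modC w by rewrite modC_gt0.
    move=> h; apply: le_trans (_ : S / d <= _); last by lra.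
    rewrite ler_pdivlMr// mulrC ler_pdivrMr// mulrC; exact: le_trans h.
  have : modC z <= 1 + modC (1 - z).
    by rewrite -{1}(subKr 1 z); apply: le_trans (modCD _ _) _; rewrite modC1 modCN.
  by move: wB; rewrite /w modCV invrK; lra.
split=> //.
have s_neq0 : s != [::] by rewrite -size_eq0 ss.
have h1 := prodmod_le_cofactors s_neq0 (fun z zs => (sB z zs).2).
have h2 := deriv_prodlin1 (fun z zs => (sB z zs).2).
have e0 := sum_cofactors_ge0 s.
(* The derivative of [D - zeta N] at 1, with [N' = D' + 1] there. Both terms on the right are
   multiples of [sum_cofactors]: the first through [|1 - zeta| = |p.[0]| prodmod s], the second by
   [deriv_prodlin1]. *)
have pd : 1 = (1 - zeta) * (1 + D^`().[1]) - p^`().[1].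
  have N1 : N^`().[1] = 1 + D^`().[1].
    by apply/eqP; rewrite -subr_eq -hornerN -hornerD -derivB Hc.
  by rewrite /p derivB derivZ !hornerE N1; ring.
have p1 : modC (1 - zeta) = modC p.[0] * prodmod s.
  by rewrite -horner_prodlin1 -modCM -hornerZ -ps /p !hornerE HD HN mulr1.
have pd1 : modC p^`().[1] = modC p.[0] * modC (prodlin s)^`().[1].
  by rewrite {1}ps derivZ hornerZ modCM.
have : 1 <= K * sum_cofactors s.
  rewrite -[leLHS](modC1 R) {1}pd; apply: le_trans (modCD _ _) _.
  rewrite modCN modCM pd1 p1.
  have t1 : modC (1 + D^`().[1]) <= 1 + modC D^`().[1].
    by apply: le_trans (modCD _ _) _; rewrite modC1.
  apply: le_trans (_ : modC p.[0] * (((1 + modC D^`().[1]) * B + (1 + B)) * sum_cofactors s) <= _).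
    rewrite -mulrA -mulrDr ler_wpM2l ?modC_ge0// mulrDl lerD//.
    rewrite [leLHS]mulrC -mulrA; apply: ler_pM => //; rewrite ?modC_ge0 ?prodmod_ge0//.
  by rewrite mulrA ler_wpM2r// /K ler_wpM2r//; have := mulr_ge0 D'1 B0; lra.
move=> h; apply: le_trans (_ : (1 + K)^-1 <= _); first by rewrite ge_min lexx orbT.
by rewrite -div1r ler_pdivrMr ?mulrDr ?mulr1 1?[_ * K]mulrC; lra.
Qed.

End StabilityPencil.

(** * Exchanging linear factors under the half-plane resolvent bound *)

Section HalfPlane.
Variables (R : realType) (K0 B : R).
Hypotheses (K00 : 0 <= K0) (B0 : 0 <= B).
Local Notation C := R[i].

(* For [J = (1 - A)^-1], the resolvent of [A] exists on the open right half
   plane and [|z (z - A)^-1| <= K]. *)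
Definition half_plane_resolvent (X : normedModType C) (K : R) (J : X -> X) : Prop :=
  forall z : C, 0 < complex.Re z ->
    (forall x, modC z * normR (J x) <= K * normR (x - (1 - z) *: J x)) /\
    (forall y, exists x, x - (1 - z) *: J x = y).

Variables (X : normedModType C) (J : {linear X -> X}).
Hypothesis HJ : half_plane_resolvent K0 J.
Implicit Types (z a : C) (x : X).

Let K1 := B + 2 * B * K0.

(** [lin a - lin z = (a - z) 'X], and the resolvent bound controls [|z| |J x|]; the modulus of [z]
    on the left is the price of the exchange. *)
Lemma factor_bound z a x : 0 < complex.Re z -> modC z <= B -> modC a <= B ->
  modC z * normR (act J (lin a) x) <= K1 * normR (act J (lin z) x).
Proof.
move=> z0 zB aB; have [h _] := HJ z0.
have -> : act J (lin a) x = act J (lin z) x + (a - z) *: J x.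
  by rewrite !act_lin -addrA -!scaleNr -scalerDl; congr (_ + _ *: _); ring.
rewrite [act J (lin z) x]act_lin in h *; set y := x - _ in h *.
apply: le_trans (ler_wpM2l (modC_ge0 _) (normRD _ _)) _.
rewrite mulrDr normRZ mulrCA /K1 mulrDl lerD//; first by rewrite ler_wpM2r ?normR_ge0.
rewrite -[leRHS]mulrA; apply: ler_pM (h x); rewrite ?mulr_ge0 ?modC_ge0 ?normR_ge0//.
by apply: le_trans (modCD _ _) _; rewrite modCN; lra.
Qed.

(** For [a = 0] the perturbation is [- z J] itself, so this exchange costs no modulus. *)
Lemma factor0_bound z x : 0 < complex.Re z ->
  normR (act J (lin 0) x) <= (1 + K0) * normR (act J (lin z) x).
Proof.
move=> z0; have [h _] := HJ z0.
have -> : act J (lin 0) x = act J (lin z) x - z *: J x.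
  by rewrite !act_lin -addrA -opprD -scalerDl; congr (_ - _ *: _); ring.
apply: le_trans (normRB _ _) _; rewrite mulrDl mul1r lerD2l normRZ act_lin.
exact: h.
Qed.

Lemma prodlin_bound (t s : seq C) x : size t = size s ->
  (forall a, a \in t -> modC a <= B) ->
  (forall z, z \in s -> 0 < complex.Re z /\ modC z <= B) ->
  prodmod s * normR (act J (prodlin t) x)
    <= K1 ^+ size s * normR (act J (prodlin s) x).
Proof.
have K10 : 0 <= K1 by rewrite addr_ge0// !mulr_ge0.
elim: t s x => [|a t IH] [|z s] // x.
  by move=> _ _ _; rewrite /prodmod /prodlin !big_nil act1.
case=> ts tB sB; have [z0 zB] := sB z (mem_head _ _).
rewrite prodmod_cons !prodlin_cons !actM exprS.
have h := factor_bound (act J (prodlin t) x) z0 zB (tB a (mem_head _ _)).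
rewrite mulrAC mulrC; apply: le_trans (ler_wpM2l (prodmod_ge0 _) h) _.
rewrite mulrCA -mulrA ler_wpM2l// (act_comm J (lin z)).
rewrite (act_comm J (lin z) (prodlin s)); apply: IH => //.
  by move=> b bt; apply: tB; rewrite inE bt orbT.
by move=> b bt; apply: sB; rewrite inE bt orbT.
Qed.

Lemma half_plane_bound x : normR (J x) <= K0 * normR x.
Proof.
have [|h _] := HJ (z := 1); first exact: ltr01.
by have := h x; rewrite modC1 mul1r subrr scale0r subr0.
Qed.

Lemma act_lin_bound a x : modC a <= B ->
  normR (act J (lin a) x) <= (1 + (1 + B) * K0) * normR x.
Proof.
move=> aB; rewrite act_lin; apply: le_trans (normRB _ _) _.
rewrite mulrDl mul1r lerD2l normRZ -mulrA; apply: ler_pM; rewrite ?modC_ge0 ?normR_ge0//.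
  by apply: le_trans (modCD _ _) _; rewrite modC1 modCN lerD2l.
exact: half_plane_bound.
Qed.

(** The factor [lin 0] can be exchanged for any one [lin z] without paying [|z|], so the product of
    all moduli improves to the products of all but one. In the induction, the term of
    [sum_cofactors] omitting [z] uses [factor0_bound]; the others exchange [a] for [z] at the price
    [|z|]. *)
Lemma prodlin0_bound (t s : seq C) x : size t = size s ->
  (forall a, a \in t -> modC a <= B) ->
  (forall z, z \in s -> 0 < complex.Re z /\ modC z <= B) ->
  sum_cofactors s * normR (act J (lin 0 * prodlin t) x)
    <= (size s)%:R * ((1 + K1) ^+ size s * ((1 + (1 + B) * K0) * (1 + K0)))
       * normR (act J (prodlin s) x).
Proof.
have K10 : 0 <= K1 by rewrite addr_ge0// !mulr_ge0.
set k := (1 + (1 + B) * K0) * (1 + K0).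
have k0 : 0 <= k by rewrite !(mulr_ge0, addr_ge0).
elim: t s x => [|a t IH] [|z s] // x; first by rewrite /= !mul0r.
case=> ts tB sB; have [z0 zB] := sB z (mem_head _ _).
have aB := tB a (mem_head _ _).
have sB' b : b \in s -> 0 < complex.Re b /\ modC b <= B.
  by move=> bt; apply: sB; rewrite inE bt orbT.
have tB' b : b \in t -> modC b <= B by move=> bt; apply: tB; rewrite inE bt orbT.
set P := normR (act J (prodlin (z :: s)) x).
set Y := normR (act J (lin 0 * prodlin (a :: t)) x).
have P0 : 0 <= P by exact: normR_ge0.
have h1 : prodmod s * Y <= K1 ^+ size s * (k * P).
  have -> : Y = normR (act J (prodlin t) (act J (lin a * lin 0) x)).
    by rewrite -actM /Y prodlin_cons; congr (normR (act J _ x)); ring.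
  apply: le_trans (prodlin_bound _ ts tB' sB') _; rewrite ler_wpM2l ?exprn_ge0//.
  rewrite act_comm actM /k -mulrA; apply: le_trans (act_lin_bound _ aB) _.
  rewrite ler_wpM2l ?(mulr_ge0, addr_ge0)//.
  by rewrite /P prodlin_cons actM; exact: factor0_bound.
have h2 : modC z * sum_cofactors s * Y <= K1 * ((size s)%:R * ((1 + K1) ^+ size s * k) * P).
  have -> : Y = normR (act J (lin a) (act J (lin 0 * prodlin t) x)).
    by rewrite -actM /Y prodlin_cons; congr (normR (act J _ x)); ring.
  rewrite mulrAC mulrC.
  apply: le_trans (ler_wpM2l (sum_cofactors_ge0 _) (factor_bound _ z0 zB aB)) _.
  rewrite mulrCA ler_wpM2l// act_comm.
  have -> : P = normR (act J (prodlin s) (act J (lin z) x)).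
    by rewrite -actM /P prodlin_cons mulrC.
  exact: IH.
rewrite [sum_cofactors _]/= mulrDl [size _]/= -[(size s).+1%:R]natr1.
apply: le_trans (lerD h1 h2) _.
set q := (1 + K1) ^+ size s; have q1 : K1 ^+ size s <= q.
  by apply: lerXn2r; rewrite ?nnegrE; lra.
have q0 : 0 <= K1 ^+ size s by rewrite exprn_ge0.
have kP : 0 <= k * P by rewrite mulr_ge0.
have e1 : K1 ^+ size s * (k * P) <= (1 + K1) * q * (k * P).
  by rewrite ler_wpM2r//; nra.
have e2 : K1 * ((size s)%:R * (q * k) * P) <= (size s)%:R * ((1 + K1) * q * (k * P)).
  rewrite (_ : K1 * _ = (size s)%:R * (K1 * q * (k * P))); last by ring.
  by rewrite ler_wpM2l// ler_wpM2r// ler_wpM2r ?(le_trans q0)// lerDr.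
apply: le_trans (lerD e1 e2) _; rewrite exprS -/q le_eqVlt; apply/orP; left.
by apply/eqP; ring.
Qed.

End HalfPlane.

(** * From root estimates to Ritt's condition *)

Section PencilKernel.
Variables (R : realType) (X : normedModType R[i]).
Local Notation C := R[i].
Implicit Types (J : {linear X -> X}) (D N : {poly C}).

Lemma act_prodlin_surj (K0 : R) J (s : seq C) : half_plane_resolvent K0 J ->
  (forall z, z \in s -> 0 < complex.Re z) ->
  forall y, exists x, act J (prodlin s) x = y.
Proof.
move=> HJ; elim: s => [|z s IH] sP y.
  by exists y; rewrite /prodlin big_nil act1.
have [x1 e1] := (HJ z (sP z (mem_head _ _))).2 y.
have [b bs|x2 e2] := IH _ x1; first by apply: sP; rewrite inE bs orbT.
by exists x2; rewrite prodlin_cons actM e2 act_lin.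
Qed.

(* [act J (lin 0) = A (1 - A)^-1] and [act J N \o S = R(A)] is the stability
   function at the operator. *)
Lemma pencil_kernel (K0 : R) D N : 0 <= K0 -> stability_pencil D N ->
  exists2 K : R, 0 <= K & forall J, half_plane_resolvent K0 J ->
    exists S : {linear X -> X},
    [/\ forall x, act J D (S x) = x,
        forall x, S (act J D x) = x,
        forall x, normR (S x) <= K * normR x &
        forall n x, n.+1%:R * normR (act J (lin 0) (iter n (act J N \o S) x))
          <= K * normR x].
Proof.
move=> K00 /pencil_factorization [n [B' [c [c0 B'0 Hf]]]].
(* Enlarged so that [1 <= B], which admits the constant factors [lin 1] in [prodlin_bound]. *)
pose B := B' + 1; have B0 : 0 <= B by rewrite /B; lra.
have BB : B' <= B by rewrite /B; lra.
have [|s0 [d0 [ss0 eD /andP[cd dB] d1 [s0P _]]]] := Hf 0; first by rewrite modC0.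
rewrite scale0r subr0 in eD; rewrite subr0 modC1 in d1.
have {}s0P z : z \in s0 -> 0 < complex.Re z /\ modC z <= B.
  by move=> /s0P[? h]; split=> //; exact: le_trans h BB.
set k1 := B + 2 * B * K0; have k10 : 0 <= k1 by rewrite addr_ge0// !mulr_ge0.
pose q := k1 ^+ n; have q0 : 0 <= q by rewrite exprn_ge0.
pose k2 := n%:R * ((1 + k1) ^+ n * ((1 + (1 + B) * K0) * (1 + K0))).
have k20 : 0 <= k2.
  have ? : 0 <= (1 + k1) ^+ n by apply: exprn_ge0; lra.
  have ? : 0 <= (1 + B) * K0 by apply: mulr_ge0; lra.
  by rewrite mulr_ge0// mulr_ge0// mulr_ge0//; lra.
pose PN : R := \sum_(i < size N) modC N`_i * K0 ^+ i.
have PN0 : 0 <= PN by apply: sumr_ge0 => i _; rewrite mulr_ge0 ?modC_ge0 ?exprn_ge0.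
(* The term [B q] serves the bound on [1 - zeta], the last term that on [V]; its two factors [c]
   bound [sum_cofactors] and the leading constant [c1] from below. *)
pose C1 := 1 + B * q + B * k2 / c ^+ 2.
have Bq : 0 <= B * q by exact: mulr_ge0.
have Bk : 0 <= B * k2 / c ^+ 2 by apply: divr_ge0; [exact: mulr_ge0|rewrite exprn_ge0// ltW].
have PNq : 0 <= PN * q by exact: mulr_ge0.
have C11 : 1 <= C1 by rewrite /C1; lra.
have M1 : 1 <= 1 + PN * q by lra.
have [K K_ge0 ritt] := @ritt_estimate R X C1 (1 + PN * q) C11 M1.
exists (q + K) => [|J HJ]; first by lra.
(* All factors of [D] are exchanged for [lin 1 = 1]; the moduli paid are cancelled by
   [|d0| prodmod s0 = 1], the case [zeta = 0]. *)
have inv_bound v : normR v <= q * normR (act J D v).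
  have h := @prodlin_bound R K0 B K00 B0 X J HJ (nseq n 1) s0 v.
  have : prodmod s0 * normR (act J (prodlin (nseq n 1)) v) <= q * normR (act J (prodlin s0) v).
    rewrite /q -{2}ss0; apply: h => //; first by rewrite size_nseq ss0.
    by move=> a; rewrite mem_nseq => /andP[_ /eqP->]; rewrite modC1 /B; lra.
  rewrite prodlin_nseq1 act1 eD actZ normRZ mulrCA => /(ler_wpM2l (modC_ge0 d0)).
  by rewrite (mulrA (modC d0) (prodmod s0)) d1 mul1r.
have surj y : exists x, act J D x = y.
  have d0N : d0 != 0 by rewrite -modC_gt0; lra.
  have [x ex] := act_prodlin_surj HJ (fun z zs => (s0P z zs).1) (d0^-1 *: y).
  by exists x; rewrite eD actZ ex scalerA mulfV// scale1r.
have inj v w : act J D v = act J D w -> v = w.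
  move=> e; apply/eqP; rewrite -subr_eq0; apply/eqP/normR_eq0.
  apply: le_anti; rewrite normR_ge0 andbT; apply: le_trans (inv_bound _) _.
  by rewrite linearB /= e subrr normR0 mulr0.
have [S0 HS0] := choice surj.
have S0lin : linear S0 by move=> a x y; apply: inj; rewrite linearP /= !HS0.
pose S : {linear X -> X} := HB.pack S0 (GRing.isLinear.Build _ _ _ _ S0 S0lin).
have SK x : normR (S x) <= q * normR x by rewrite -{2}(HS0 x); exact: inv_bound.
exists S; split.
- exact: HS0.
- by move=> x; apply: inj; rewrite HS0.
- by move=> x; apply: le_trans (SK x) _; rewrite ler_wpM2r ?normR_ge0// lerDl.
move=> m x; apply: le_trans (_ : K * normR x <= _); last first.
  by rewrite ler_wpM2r ?normR_ge0// lerDr.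
apply: (ritt (act J N \o S) (act J (lin 0))).
  move=> y /=; apply: le_trans (normR_act _ _ K00 (half_plane_bound HJ)) _.
  rewrite -/PN; apply: le_trans (ler_wpM2l PN0 (SK y)) _.
  by rewrite mulrA ler_wpM2r ?normR_ge0// lerDr.
move=> zeta y zeta1.
have [s [c1 [ss eDz /andP[c1c c1B] e1 [sP cof]]]] := Hf zeta zeta1.
have {}sP z : z \in s -> 0 < complex.Re z /\ modC z <= B.
  by move=> /sP[? h]; split=> //; exact: le_trans h BB.
have sz : size s0 = size s by rewrite ss ss0.
(* Writing [y = D(J) v] turns both resolvent bounds into comparisons of polynomials in [J] applied
   to [v]. *)
have -> : y - zeta *: (act J N \o S) y = act J (D - zeta *: N) (S y).
  by rewrite actB actZ /= HS0.
set v := S y; have ey : y = act J D v by rewrite [RHS]HS0.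
clearbody v; rewrite {y}ey; set P := normR (act J (prodlin s) v).
have P0 : 0 <= P := normR_ge0 _.
have eP : normR (act J (D - zeta *: N) v) = modC c1 * P by rewrite eDz actZ normRZ.
have c10 : 0 <= modC c1 := modC_ge0 _.
rewrite eP; split.
  rewrite eD actZ normRZ -e1.
  have h := prodlin_bound K00 B0 HJ v sz (fun z zs => (s0P z zs).2) sP.
  rewrite ss -/q -/P in h.
  have : modC c1 * modC d0 * (prodmod s * normR (act J (prodlin s0) v)) <= modC c1 * B * (q * P).
    apply: ler_pM; rewrite ?mulr_ge0 ?prodmod_ge0 ?normR_ge0 ?modC_ge0//.
    by rewrite ler_wpM2l// (le_trans dB).
  move=> h'; apply: le_trans (_ : modC c1 * B * (q * P) <= _).
    by move: h'; congr (_ <= _); ring.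
  rewrite (_ : modC c1 * B * (q * P) = B * q * (modC c1 * P)); last by ring.
  by rewrite ler_wpM2r ?mulr_ge0// /C1; lra.
have h := prodlin0_bound K00 B0 HJ v sz (fun z zs => (s0P z zs).2) sP.
rewrite ss -/k1 -/k2 -/P actM in h.
rewrite eD actZ linearZ normRZ /=.
set Y := normR _ in h *; have Y0 : 0 <= Y := normR_ge0 _.
have Y1 : Y <= k2 * P / c.
  by rewrite ler_pdivlMr// mulrC; apply: le_trans h; rewrite ler_wpM2r.
apply: le_trans (_ : B * (k2 * P / c) <= _).
  by apply: ler_pM; rewrite ?modC_ge0// (le_trans dB).
have cP : c * P <= modC c1 * P by rewrite ler_wpM2r.
have : B * k2 / c ^+ 2 * (c * P) <= B * k2 / c ^+ 2 * (modC c1 * P) by rewrite ler_wpM2l.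
have -> : B * k2 / c ^+ 2 * (c * P) = B * (k2 * P / c) by field; rewrite gt_eqF.
move/le_trans; apply; rewrite ler_wpM2r ?mulr_ge0// /C1; lra.
Qed.

End PencilKernel.

(** * The pencil of a Runge-Kutta method *)

Section Pencil.
Variables (R : realType) (s : nat) (Q : 'M[R]_s) (b : 'cV[R]_s).
Local Notation C := R[i].

Definition polyQ : 'M[{poly C}]_s := map_mx polyC (map_mx (real_complex R) Q).
Definition polyb : 'cV[{poly C}]_s := map_mx polyC (map_mx (real_complex R) b).

(** At [w = 1 / (1 - z)] this is [w (I - z Q)]; it stays polynomial at [w = 0], where it equals
    [Q]. *)
Definition pencil : 'M[{poly C}]_s := 'X *: (1%:M - polyQ) + polyQ.
Definition pencil_den : {poly C} := \det pencil.
(** Cramer's rule: [(I - z Q)^-1 = w adj(pencil) / D] and [z w = w - 1], so this is [D] times the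
    stability function. *)
Definition pencil_num : {poly C} :=
  pencil_den + ('X - 1) * (polyb^T *m \adj pencil *m (const_mx 1 : 'cV_s)) 0 0.

Let Qc := map_mx (real_complex R) Q.
Let bc := map_mx (real_complex R) b.
Let pencil_at (w : C) : 'M[C]_s := w *: (1%:M - Qc) + Qc.

Lemma horner_pencil w : map_mx (horner_eval w) pencil = pencil_at w.
Proof.
apply/matrixP => i j; rewrite !mxE /horner_eval !hornerE.
by case: (i == j); rewrite ?mulr1n ?mulr0n !hornerE.
Qed.

Lemma horner_pencil_den w : pencil_den.[w] = \det (pencil_at w).
Proof. by rewrite -horner_pencil det_map_mx. Qed.

Lemma horner_weighted_adj w :
  ((polyb^T *m \adj pencil *m (const_mx 1 : 'cV_s)) 0 0).[w]
  = (bc^T *m \adj (pencil_at w) *m (const_mx 1 : 'cV_s)) 0 0.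
Proof.
rewrite -horner_pencil -map_mx_adj -/(horner_eval w _).
have -> : bc^T = map_mx (horner_eval w) polyb^T.
  by apply/matrixP => i j; rewrite !mxE /horner_eval hornerC.
have -> : const_mx 1 = map_mx (horner_eval w) (const_mx 1) :> 'cV[C]_s.
  by apply/matrixP => i j; rewrite !mxE /horner_eval hornerC.
by rewrite -!map_mxM [RHS]mxE.
Qed.

Lemma horner_pencil_num w : pencil_num.[w]
  = pencil_den.[w] + (w - 1) * (bc^T *m \adj (pencil_at w) *m (const_mx 1 : 'cV_s)) 0 0.
Proof. by rewrite /pencil_num !hornerE horner_weighted_adj. Qed.

Lemma adj_unit n (M : 'M[C]_n) : M \in unitmx -> \adj M = \det M *: invmx M.
Proof.
by move=> Mu; rewrite /invmx Mu scalerA mulfV ?scale1r// -unitfE -unitmxE.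
Qed.

(** At [w = 0] the pencil is [Q] and the quotient is [R(oo)]; at [w = 1] it is the identity, so the
    derivative of [N - D] is the sum of the weights. *)
Lemma runge_kutta_pencil : A_stable Q b -> Q \in unitmx ->
  `|stability_infty Q b| < 1 -> \sum_i b i 0 = 1 ->
  stability_pencil pencil_den pencil_num.
Proof.
move=> stab Qu Rinf sum_b.
have at1 : pencil_at 1 = 1%:M by rewrite /pencil_at scale1r subrK.
have at0 : pencil_at 0 = Qc by rewrite /pencil_at scale0r add0r.
have Qcu : Qc \in unitmx by rewrite map_unitmx.
split.
- rewrite horner_pencil_num horner_pencil_den at0 adj_unit// -scalemxAr -scalemxAl.
  rewrite [X in _ * X]mxE sub0r mulN1r -[X in X - _]mulr1 -mulrBr modCM.
  have -> : 1 - (bc^T *m invmx Qc *m (const_mx 1 : 'cV_s)) 0 0 = (stability_infty Q b)%:C.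
    rewrite /stability_infty rmorphB rmorph1; congr (_ - _).
    have -> : const_mx 1 = map_mx (real_complex R) (const_mx 1) :> 'cV[C]_s.
      by apply/matrixP => i j; rewrite !mxE rmorph1.
    have -> : bc^T = map_mx (real_complex R) b^T by apply/matrixP => i j; rewrite !mxE.
    by rewrite -map_invmx -!map_mxM mxE.
  rewrite modCR -[ltRHS]mulr1 ltr_pM2l// modC_gt0.
  by move: Qcu; rewrite unitmxE unitfE.
- by rewrite horner_pencil_den at1 det1.
- by rewrite horner_pencil_num subrr mul0r addr0 horner_pencil_den at1 det1.
- rewrite /pencil_num addrC addKr derivM derivB derivX derivC subr0 mul1r.
  rewrite hornerD hornerM !hornerE subrr mul0r addr0.
  rewrite horner_weighted_adj at1 adj_unit ?unitmx1// det1 scale1r invmx1 mulmx1 mxE.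
  rewrite -[RHS](rmorph1 (real_complex R)) -sum_b rmorph_sum.
  by apply: eq_bigr => i _; rewrite !mxE mulr1.
move=> w zeta w0 rew zeta1; set z := 1 - w^-1 in rew.
have [Su Sle] := stab z rew.
have atw : pencil_at w = w *: stage_matrix Q z.
  rewrite /stage_matrix -/Qc /pencil_at scalerBr scalerBr scalerA /z mulrBr mulr1 mulfV//.
  by rewrite scalerBl scale1r opprB addrA addrAC.
have atwu : pencil_at w \in unitmx.
  by rewrite atw unitmxZ// unitfE.
have d0 : pencil_den.[w] != 0.
  by rewrite horner_pencil_den -unitfE -unitmxE.
have numE : pencil_num.[w] = pencil_den.[w] * stability_fun Q b z.
  rewrite horner_pencil_num adj_unit// -scalemxAr -scalemxAl -horner_pencil_den.
  rewrite [X in _ + _ * X]mxE /stability_fun mulrDr mulr1; congr (_ + _).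
  have -> : (bc^T *m invmx (pencil_at w) *m (const_mx 1 : 'cV_s)) 0 0
      = w^-1 * (bc^T *m invmx (stage_matrix Q z) *m (const_mx 1 : 'cV_s)) 0 0.
    have -> : invmx (pencil_at w) = w^-1 *: invmx (stage_matrix Q z).
      by rewrite atw; apply: invmxZ; rewrite -atw.
    by rewrite -scalemxAr -scalemxAl mxE.
  have ez : z = (w - 1) * w^-1 by rewrite mulrBl mul1r mulfV.
  by rewrite ez mulrCA -[in RHS]mulrA.
(* [D - zeta N = D (1 - zeta R(z))], and [|zeta R(z)| < 1] by A-stability. *)
rewrite hornerD hornerN hornerZ numE -[X in X - _]mulr1 mulrCA -mulrBr mulf_neq0// subr_eq0.
apply/eqP => h; have : modC (zeta * stability_fun Q b z) < 1.
  rewrite modCM; apply: le_lt_trans zeta1; rewrite ler_piMr ?modC_ge0//.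
  by rewrite -lecR -modCE.
by rewrite -h modC1 ltxx.
Qed.

End Pencil.

Lemma of_class_C_cst (R : realType) (V W : normedModType R) (k : nat) (c : W) :
  of_class_C k (fun _ : V => c).
Proof.
elim: k c => [|k IH] c; first exact: cst_continuous.
move=> v; split=> [x|]; first exact: derivable_cst.
have -> : (fun x => 'D_v (fun _ : V => c) x) = (fun _ => 0).
  by apply/funext => x; exact: derive_cst.
exact: IH.
Qed.

(* Test the order condition on [y' = 1]. *)
Lemma order1_sum_weights (R : realType) (s : nat) (Q : 'M[R]_s) (b c : 'cV[R]_s) :
  rk_order_ge Q b c 1 -> \sum_i b i 0 = 1.
Proof.
move=> ord; pose e : 'rV[R]_1 := const_mx 1.
have [] := ord 1%N (fun=> e) 0 (fun t => t *: e) (fun h i => h *: \sum_(j < s) Q i j *: e).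
- by move=> k; exact: of_class_C_cst.
- near=> t.
  have q : h^-1 *: (((fun t => t *: e) \o shift t) (h *: (1 : R)) - t *: e) @[h --> 0^'] --> e.
    apply: cvg_near_cst; near=> h.
    have h0 : h != 0 by near: h; exact: nbhs_dnbhs_neq.
    by rewrite /= scalerDl addrK [h *: 1]mulr1 scalerA mulVf// scale1r.
  by apply: DeriveDef; [exact: cvgP q|exact: cvg_lim q].
- move=> i; apply: cvg_at_right_filter; rewrite scale0r -[0 in X in _ --> X](scale0r (\sum_(j < s) Q i j *: e)).
  exact: scalel_continuous.
- by near=> h => i; rewrite scale0r add0r.
move=> K HK; set beta := \sum_i b i 0; apply/eqP; rewrite -subr_eq0; apply/negPn/negP => beta1.
have e0 : 0 < `|(beta - 1) *: e|.
  rewrite normr_gt0 scaler_eq0 negb_or beta1 /=; apply/eqP => /matrixP /(_ 0 0).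
  by rewrite !mxE => /eqP; rewrite oner_eq0.
set d := `|_| in e0.
have K1 : 0 < `|K| + 1 by rewrite ltr_pwDr.
near (0 : R)^'+ => h.
have h0 : 0 < h by near: h; exact: nbhs_right_gt.
have hd : h < d / (`|K| + 1) by near: h; apply: nbhs_right_lt; rewrite divr_gt0.
have : `|0 *: e + h *: (\sum_(i < s) b i 0 *: e) - (0 + h) *: e| <= K * h ^+ 2.
  by near: h.
rewrite scale0r !add0r -scaler_suml -/beta -scalerBr -[X in _ - X]scale1r -scalerBl normrZ gtr0_norm// -/d.
rewrite expr2 mulrCA ler_pM2l// => dK.
move: hd; rewrite ltr_pdivlMr// => hd.
have : K * h <= `|K| * h by rewrite ler_wpM2r ?(ltW h0)// ler_norm.
by lra.
Unshelve. all: by end_near.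
Qed.

(** * Polynomial matrices acting on stage vectors *)

Section MatrixAction.
Variables (R : realType) (X : normedModType R[i]) (J : {linear X -> X}).
Local Notation C := R[i].

Definition mxact m n (M : 'M[{poly C}]_(m, n)) (V : 'I_n -> X) (i : 'I_m) : X :=
  \sum_j act J (M i j) (V j).

Lemma mxactM m n p (M : 'M[{poly C}]_(m, n)) (N : 'M[{poly C}]_(n, p)) V i :
  mxact (M *m N) V i = mxact M (mxact N V) i.
Proof.
rewrite /mxact; under eq_bigr do rewrite mxE act_sum.
rewrite exchange_big; apply: eq_bigr => j _ /=.
by rewrite linear_sum; apply: eq_bigr => k _; rewrite actM.
Qed.

Lemma mxact_scalar n (p : {poly C}) (V : 'I_n -> X) i : mxact p%:M V i = act J p (V i).
Proof.
rewrite /mxact (bigD1 i)//= big1 ?addr0; last first.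
  by move=> j /negbTE ji; rewrite mxE eq_sym ji mulr0n act0.
by rewrite mxE eqxx mulr1n.
Qed.

Lemma mxactD m n (M : 'M[{poly C}]_(m, n)) V W i :
  mxact M (fun j => V j + W j) i = mxact M V i + mxact M W i.
Proof. by rewrite /mxact -big_split; apply: eq_bigr => j _; rewrite linearD. Qed.

Lemma mxactZ m n (M : 'M[{poly C}]_(m, n)) (a : C) V i :
  mxact M (fun j => a *: V j) i = a *: mxact M V i.
Proof. by rewrite /mxact scaler_sumr; apply: eq_bigr => j _; rewrite linearZ. Qed.

Lemma act_mxact m n (M : 'M[{poly C}]_(m, n)) p V i :
  act J p (mxact M V i) = mxact M (fun j => act J p (V j)) i.
Proof.
by rewrite /mxact linear_sum; apply: eq_bigr => j _; rewrite /= act_comm.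
Qed.

Lemma mxact_addmx m n (M N : 'M[{poly C}]_(m, n)) V i :
  mxact (M + N) V i = mxact M V i + mxact N V i.
Proof. by rewrite /mxact -big_split; apply: eq_bigr => j _; rewrite mxE actD. Qed.

Lemma mxact_oppmx m n (M : 'M[{poly C}]_(m, n)) V i :
  mxact (- M) V i = - mxact M V i.
Proof. by rewrite /mxact -sumrN; apply: eq_bigr => j _; rewrite mxE actN. Qed.

Lemma mxact_scalemx m n (p : {poly C}) (M : 'M[{poly C}]_(m, n)) V i :
  mxact (p *: M) V i = act J p (mxact M V i).
Proof.
by rewrite /mxact linear_sum; apply: eq_bigr => j _; rewrite mxE actM.
Qed.

Lemma mxact_constmx m n (M : 'M[C]_(m, n)) V i :
  mxact (map_mx polyC M) V i = \sum_j M i j *: V j.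
Proof. by apply: eq_bigr => j _; rewrite mxE actC. Qed.

End MatrixAction.

Definition mxact_norm (R : realType) (M0 : R) m n (M : 'M[{poly R[i]}]_(m, n)) : R :=
  \sum_i \sum_j \sum_(k < size (M i j)) modC (M i j)`_k * M0 ^+ k.

Lemma mxact_norm_ge0 (R : realType) (M0 : R) m n (M : 'M[{poly R[i]}]_(m, n)) :
  0 <= M0 -> 0 <= mxact_norm M0 M.
Proof.
move=> M00; apply: sumr_ge0 => i _; apply: sumr_ge0 => j _; apply: sumr_ge0 => k _.
by rewrite mulr_ge0 ?modC_ge0 ?exprn_ge0.
Qed.

Lemma normR_mxact (R : realType) (X : normedModType R[i]) (J : {linear X -> X})
    (M0 f : R) m n (M : 'M[{poly R[i]}]_(m, n)) V i :
  0 <= M0 -> (forall y, normR (J y) <= M0 * normR y) ->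
  (forall j, normR (V j) <= f) -> normR (mxact J M V i) <= mxact_norm M0 M * f.
Proof.
move=> M00 JM Vf; apply: le_trans (normR_sum _ _ _) _.
have p0 (p : {poly R[i]}) : 0 <= \sum_(k < size p) modC p`_k * M0 ^+ k.
  by apply: sumr_ge0 => k _; rewrite mulr_ge0 ?modC_ge0 ?exprn_ge0.
apply: le_trans (_ : \sum_j (\sum_(k < size (M i j)) modC (M i j)`_k * M0 ^+ k) * f <= _).
  apply: ler_sum => j _; apply: le_trans (normR_act _ _ M00 JM) _.
  by rewrite ler_wpM2l.
rewrite -mulr_suml.
have [n0|n0] := posnP n.
  move: i M V Vf; rewrite n0 => i M V _; rewrite big_ord0 mul0r.
  by rewrite /mxact_norm big1 ?mul0r// => k _; rewrite big_ord0.
have f0 : 0 <= f := le_trans (normR_ge0 _) (Vf (Ordinal n0)).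
rewrite ler_wpM2r// /mxact_norm [leRHS](bigD1 i)//= lerDl.
by apply: sumr_ge0 => k _; apply: sumr_ge0 => j _; exact: p0.
Qed.

(** * The resolvent of [tau A] on the right half plane *)

Section Cayley.
Variables (R : realType) (X : completeNormedModType R[i]) (D : set X) (A : X -> X).
Local Notation C := R[i].

(** The domain is the range of the linear map [B], on which [A = lambda - B^-1]; this is the source
    of the linearity of [A]. *)
Lemma resolvent_domain_linear (lambda : C) (B : X -> X) :
  is_resolvent D A lambda B -> forall (a : C) x y, D x -> D y ->
    D (a *: x + y) /\ A (a *: x + y) = a *: A x + A y.
Proof.
move=> [[Blin _] BD DB] a x y Dx Dy.
pose p := lambda *: x - A x; pose q := lambda *: y - A y.
have e : a *: x + y = B (a *: p + q) by rewrite Blin !DB.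
have [h1 h2] := BD (a *: p + q); rewrite -e in h1 h2; split=> //.
have -> : A (a *: x + y) = lambda *: (a *: x + y) - (a *: p + q).
  by rewrite -h2 subKr.
rewrite /p /q scalerBr scalerDr !scalerA [lambda * a]mulrC opprD !opprB.
rewrite addrACA; congr (_ + _); first by rewrite addrC subrK.
by rewrite addrC subrK.
Qed.

Lemma half_plane_sector (theta : R) (z : C) : pi / 2 < theta ->
  0 < complex.Re z -> sector theta z.
Proof.
case: z => x y /= th x0; exists (Num.sqrt (x ^+ 2 + y ^+ 2)), (atan (y / x)).
have r2 : 0 < x ^+ 2 + y ^+ 2 by rewrite ltr_wpDr ?sqr_ge0// exprn_gt0.
have eq1 : Num.sqrt (x ^+ 2 + y ^+ 2) * cos (atan (y / x)) = x.
  rewrite cos_atan.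
  have -> : x ^+ 2 + y ^+ 2 = x ^+ 2 * (1 + (y / x) ^+ 2) by field; rewrite gt_eqF.
  rewrite sqrtrM ?sqr_ge0// sqrtr_sqr gtr0_norm// mulfK// gt_eqF//.
  by rewrite sqrtr_gt0 ltr_wpDr ?sqr_ge0.
split.
- by rewrite sqrtr_gt0.
- by rewrite ltr_norml (lt_trans (atan_ltpi2 _))// andbT (lt_trans _ (atan_gtNpi2 _))// ltrN2.
- congr (_ +i* _); first by rewrite eq1.
  have c0 : cos (atan (y / x)) != 0.
    by apply/eqP => h; move: eq1; rewrite h mulr0 => h'; rewrite -h' ltxx in x0.
  have -> : sin (atan (y / x)) = y / x * cos (atan (y / x)).
    set t := atan _ in c0 *; have e : sin t / cos t = y / x by exact: atanK.
    by rewrite -e divfK.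
  by rewrite mulrCA eq1 divfK// gt_eqF.
Qed.

(* [J] is [(1 - tau A)^-1]. *)
Lemma cayley_resolvent (theta : R) : pi / 2 < theta -> uniformly_sectorial D A theta ->
  exists2 K0 : R, 0 <= K0 & forall tau : R, 0 < tau ->
  exists J : {linear X -> X}, [/\ half_plane_resolvent K0 J,
    forall v, D (J v), forall v, J v - tau%:C *: A (J v) = v &
    forall x, D x -> J (x - tau%:C *: A x) = x].
Proof.
move=> th [M HM]; exists (1 + `|M|) => [|tau tau0]; first by rewrite addr_ge0.
have t0 : tau%:C != 0 :> C by rewrite fmorph_eq0 gt_eqF.
pose it : C := (tau%:C)^-1.
(* The sector is a cone, so [z / tau] stays in it and the bound [M] is independent of [tau]. *)
have res z : 0 < complex.Re z -> exists B, is_resolvent D A (it * z) B /\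
    forall x, normR (A (B x)) <= M * normR x.
  move=> z0; apply: HM; apply: half_plane_sector => //.
  rewrite /it -real_complexV; case: z z0 => x y /= x0.
  by rewrite mul0r subr0 mulr_gt0// invr_gt0.
have [B1 [RB1 _]] := res 1 ltr01; rewrite mulr1 in RB1.
have [[B1lin _] BD1 DB1] := RB1.
have AZ a x : D x -> D (a *: x) /\ A (a *: x) = a *: A x.
  move=> Dx; have := resolvent_domain_linear RB1 (a - 1) Dx Dx.
  have e (w : X) : (a - 1) *: w + w = a *: w by rewrite scalerBl scale1r subrK.
  by rewrite !e.
pose B1l : {linear X -> X} := HB.pack B1 (GRing.isLinear.Build _ _ _ _ B1 B1lin).
have [J JE] : exists J : {linear X -> X}, forall v, J v = it *: B1 v.
  by exists (it \*: B1l).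
have J1 v : D (J v) by rewrite JE; apply: (AZ _ _ _).1; have [] := BD1 v.
have J2 v : J v - tau%:C *: A (J v) = v.
  have [DB e] := BD1 v; rewrite JE (AZ _ _ DB).2 scalerA mulfV// scale1r.
  exact: e.
have J3 x : D x -> J (x - tau%:C *: A x) = x.
  move=> Dx; rewrite JE -[RHS](DB1 x Dx) -[B1 _]/(B1l _) -linearZ /=.
  by rewrite scalerBr scalerA mulVf// scale1r.
exists J; split=> // z z0.
have [Bz [[[Bzlin _] BDz DBz] Bzb]] := res z z0.
pose Bzl : {linear X -> X} := HB.pack Bz (GRing.isLinear.Build _ _ _ _ Bz Bzlin).
split=> [x|y].
  set a := J x; have Da : D a := J1 x.
  set g := x - (1 - z) *: a.
  (* [g] is [(z - tau A) J x], so the resolvent at [z / tau] maps it to [tau J x]. *)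
  have eg : g = tau%:C *: ((it * z) *: a - A a).
    have ti : tau%:C * (it * z) = z by rewrite mulrA mulfV// mul1r.
    have ex : x = a - tau%:C *: A a by rewrite J2.
    rewrite scalerBr (scalerA tau%:C (it * z)) ti /g {1}ex scalerBl scale1r.
    by rewrite opprB addrC addrA subrK.
  have eB : Bz g = tau%:C *: a.
    by rewrite eg -[LHS]/(Bzl _) linearZ /= -[Bz _]/(Bz _) DBz.
  have : z *: a = g + A (Bz g).
    have [_ e] := BDz g; rewrite -{1}e subrK eB scalerA mulrAC mulVf// mul1r.
    by [].
  move/(congr1 (@normR R X)); rewrite normRZ => ->; apply: le_trans (normRD _ _) _.
  rewrite mulrDl mul1r lerD2l; apply: le_trans (Bzb g) _.
  by rewrite ler_wpM2r ?normR_ge0// ler_norm.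
have [DB e] := BDz y; have [Da Aa] := AZ it _ DB.
exists (it *: Bz y - tau%:C *: A (it *: Bz y)); rewrite (J3 _ Da).
rewrite Aa [in tau%:C *: _]scalerA mulfV// scale1r scalerBl scale1r opprB addrC addrA subrK.
by rewrite scalerA [z * it]mulrC.
Qed.

End Cayley.

(** * Runge-Kutta trajectories *)

Lemma subn_predS (k m : nat) : (k < m)%N -> (m - k = (m.-1 - k).+1)%N.
Proof. lia. Qed.

Section RungeKutta.
Variables (R : realType) (X : completeNormedModType R[i]) (D : set X) (A : X -> X).
Variables (s : nat) (Q : 'M[R]_s) (b c : 'cV[R]_s).
Local Notation C := R[i].

Section Step.
Variables (tau : R) (J S : {linear X -> X}).
Hypotheses (J_dom : forall v, D (J v))
  (J_res : forall v, J v - tau%:C *: A (J v) = v)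
  (J_inv : forall x, D x -> J (x - tau%:C *: A x) = x)
  (S_right : forall x, act J (pencil_den Q) (S x) = x)
  (S_left : forall x, S (act J (pencil_den Q) x) = x).

Lemma inverse_act p x : S (act J p x) = act J p (S x).
Proof. by rewrite -{1}(S_right x) act_comm S_left. Qed.

Lemma inverse_mxact m n (M : 'M[{poly C}]_(m, n)) V i :
  S (mxact J M V i) = mxact J M (fun j => S (V j)) i.
Proof.
by rewrite /mxact linear_sum; apply: eq_bigr => j _; rewrite /= inverse_act.
Qed.

Lemma tauA_J v : tau%:C *: A (J v) = J v - v.
Proof. by rewrite -{3}(J_res v) subKr. Qed.

Lemma act_lin0 v : act J (lin 0) v = - (tau%:C *: A (J v)).
Proof. by rewrite act_lin subr0 scale1r tauA_J opprB. Qed.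

(** [J (1 - Q) + Q = J - Q (J - 1)] and [J - 1 = tau A J]: the pencil at [J] is the stage operator
    [1 - tau Q A] composed with [J]. *)
Lemma mxact_pencil (V : 'I_s -> X) i :
  mxact J (pencil Q) V i = J (V i) - \sum_j (Q i j)%:C *: (tau%:C *: A (J (V j))).
Proof.
have mQ W k : mxact J (polyQ Q) W k = \sum_j (Q k j)%:C *: W j.
  by rewrite mxact_constmx; apply: eq_bigr => j _; rewrite mxE.
rewrite /pencil mxact_addmx mxact_scalemx mxact_addmx mxact_oppmx mxact_scalar act1 actX.
rewrite !mQ linearB linear_sum /= -addrA; congr (_ + _).
rewrite -sumrN -big_split -sumrN; apply: eq_bigr => j _ /=.
by rewrite linearZ /= tauA_J scalerBr opprB addrC.
Qed.

(** For [V = (1 - tau A) U] the stage system is [pencil V = G]; the adjugate reduces it to scalar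
    equations with the determinant, which [S] inverts. *)
Lemma stage_uniqueness (u : X) (F U : 'I_s -> X) :
  (forall i, D (U i)) ->
  (forall i, U i = u + tau%:C *: \sum_j (Q i j)%:C *: (A (U j) + F j)) ->
  forall i, U i - tau%:C *: A (U i)
    = S (mxact J (\adj (pencil Q)) (fun j => u + tau%:C *: \sum_k (Q j k)%:C *: F k) i).
Proof.
move=> DU eU i; set V := fun i => U i - tau%:C *: A (U i).
have JV j : J (V j) = U j by exact: J_inv.
rewrite -/(V i) -(S_left (V i)) -(mxact_scalar J _ V) -mul_adj_mx mxactM.
congr (S (mxact J _ _ i)); apply/funext => j.
rewrite mxact_pencil JV {1}eU -addrA; congr (_ + _).
rewrite !scaler_sumr -sumrN -big_split; apply: eq_bigr => k _ /=.
by rewrite JV !scalerDr !scalerA [(Q j k)%:C * _]mulrC addrAC subrr add0r.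
Qed.

Lemma stage_existence (u : X) (F : 'I_s -> X) :
  let U i := J (S (mxact J (\adj (pencil Q)) (fun j => u + tau%:C *: \sum_k (Q j k)%:C *: F k) i)) in
  forall i, U i = u + tau%:C *: \sum_j (Q i j)%:C *: (A (U j) + F j).
Proof.
move=> U i; pose G j := u + tau%:C *: \sum_k (Q j k)%:C *: F k.
pose V := fun i => S (mxact J (\adj (pencil Q)) G i).
have MV : mxact J (pencil Q) V i = G i.
  have -> : V = mxact J (\adj (pencil Q)) (fun j => S (G j)).
    by apply/funext => j; rewrite /V inverse_mxact.
  by rewrite -mxactM mul_mx_adj mxact_scalar S_right.
move: MV; rewrite mxact_pencil => /eqP; rewrite subr_eq => /eqP.
rewrite -[J (V i)]/(U i) => ->; rewrite /G -addrA; congr (_ + _).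
rewrite !scaler_sumr -big_split; apply: eq_bigr => k _ /=.
by rewrite !scalerDr !scalerA [(Q i k)%:C * _]mulrC addrC.
Qed.

Hypothesis Q_inv : Q \in unitmx.

(** Since [tau Q dU = U - u], the update becomes [u + beta (U - u)], free of the increments. *)
Let beta : 'rV[R]_s := b^T *m invmx Q.
Let betaP : 'rV[{poly C}]_s := map_mx polyC (map_mx (real_complex R) beta).
Definition source_row : 'rV[{poly C}]_s := betaP *m \adj (pencil Q) *m polyQ Q.

Lemma betaP_Q : betaP *m polyQ Q = (polyb b)^T.
Proof.
rewrite /betaP /polyQ -!map_mxM /beta mulmxKV//.
by apply/matrixP => i j; rewrite !mxE.
Qed.

(** From [('X - 1) Q = 'X - pencil], multiplied by the adjugate. *)
Lemma pencil_numE : pencil_num Q b = pencil_den Q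
  + 'X * (betaP *m \adj (pencil Q) *m (const_mx 1 : 'cV_s)) 0 0
  - pencil_den Q * (betaP *m (const_mx 1 : 'cV_s)) 0 0.
Proof.
rewrite /pencil_num -addrA; congr (_ + _).
have e : 'X *: \adj (pencil Q) - (pencil_den Q)%:M = ('X - 1) *: (polyQ Q *m \adj (pencil Q)).
  rewrite /pencil_den -mul_mx_adj -[in 'X *: _](mul1mx (\adj _)) scalemxAl -mulmxBl scalemxAl.
  congr (_ *m _); rewrite /pencil scalerBr opprD opprB addrA subrKC.
  by rewrite scalerBl scale1r.
have := congr1 (fun M => (betaP *m M *m (const_mx 1 : 'cV_s)) 0 0) e.
rewrite mulmxBr mulmxBl -!scalemxAr -!scalemxAl mulmxA betaP_Q mul_mx_scalar -!scalemxAl.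
by rewrite !mxE => ->.
Qed.

(** One step for the lifted value [y = (1 - tau A) u]: the homogeneous part is the stability
    function at [tau A], the source a bounded operator applied to [tau F]. *)
Lemma pencil_den_step (y : X) (F V : 'I_s -> X) :
  (forall i, V i = S (mxact J (\adj (pencil Q))
    (fun j => J y + tau%:C *: \sum_k (Q j k)%:C *: F k) i)) ->
  y + mxact J betaP (fun j => V j - y) 0
  = S (act J (pencil_num Q b) y) + tau%:C *: S (mxact J source_row F 0).
Proof.
move=> eV; pose one : 'cV[{poly C}]_s := const_mx 1.
have mone v : mxact J one (fun _ : 'I_1 => v) = (fun _ => v).
  by apply/funext => i; rewrite /mxact big_ord1 mxE act1.
have m11 (M : 'M[{poly C}]_1) v : mxact J M (fun _ => v) 0 = act J (M 0 0) v.
  by rewrite /mxact big_ord1.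
have mQ W k : mxact J (polyQ Q) W k = \sum_j (Q k j)%:C *: W j.
  by rewrite mxact_constmx; apply: eq_bigr => j _; rewrite mxE.
set G := fun j => _ in eV.
have -> : mxact J betaP (fun j => V j - y) 0
    = mxact J betaP V 0 - act J ((betaP *m one) 0 0) y.
  rewrite -m11 mxactM mone -scaleN1r -mxactZ -mxactD.
  by congr (mxact J _ _ 0); apply/funext => j; rewrite scaleN1r.
have -> : V = fun i => S (mxact J (\adj (pencil Q)) G i) by apply/funext.
rewrite -inverse_mxact.
have -> : mxact J (\adj (pencil Q)) G = fun i => mxact J (\adj (pencil Q)) (fun=> J y) i
    + tau%:C *: mxact J (\adj (pencil Q)) (mxact J (polyQ Q) F) i.
  apply/funext => i; rewrite -mxactZ -mxactD; congr (mxact J _ _ i).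
  by apply/funext => j; rewrite mQ.
rewrite mxactD mxactZ linearD linearZ /=.
have -> : mxact J betaP (fun i => mxact J (\adj (pencil Q)) (mxact J (polyQ Q) F) i) 0
    = mxact J source_row F 0 by rewrite /source_row !mxactM.
have -> : mxact J betaP (fun i => mxact J (\adj (pencil Q)) (fun=> J y) i) 0
    = act J ((betaP *m \adj (pencil Q) *m one) 0 0 * 'X) y.
  by rewrite actMX -m11 !mxactM mone.
rewrite pencil_numE actB actD linearB linearD /= [in act J ('X * _) y]mulrC actM.
rewrite [act J (pencil_den Q * _) y]actM !S_left -!addrA; congr (_ + (_ + _)).
by rewrite addrC.
Qed.

End Step.

Section Trajectory.
Variable theta : R.
Hypotheses (theta_gt : pi / 2 < theta) (A_sect : uniformly_sectorial D A theta).
Hypotheses (rk_stable : A_stable Q b) (Q_inv : Q \in unitmx)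
  (R_infty : `|stability_infty Q b| < 1) (sum_b : \sum_i b i 0 = 1).

(* [act J (pencil_den Q)] is [det (1 - tau Q A) J^s] and [S] is its inverse. *)
Lemma discretization : exists K0 K : R, [/\ 0 <= K0, 0 <= K &
  forall tau : R, 0 < tau -> exists J S : {linear X -> X},
  [/\ forall v, D (J v), forall v, J v - tau%:C *: A (J v) = v,
    forall x, D x -> J (x - tau%:C *: A x) = x,
    forall v, normR (J v) <= K0 * normR v &
  [/\ forall x, act J (pencil_den Q) (S x) = x,
    forall x, S (act J (pencil_den Q) x) = x,
    forall x, normR (S x) <= K * normR x &
    forall n x, n.+1%:R * normR (act J (lin 0) (iter n (act J (pencil_num Q b) \o S) x))
      <= K * normR x]]].
Proof.
have [K0 K00 HJ] := cayley_resolvent theta_gt A_sect.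
have pen := runge_kutta_pencil rk_stable Q_inv R_infty sum_b.
have [K K_ge0 HK] := @pencil_kernel R X K0 _ _ K00 pen.
exists K0, K; split=> // tau tau0.
have [J [Jhp J1 J2 J3]] := HJ tau tau0.
have [S [S1 S2 S3 S4]] := HK J Jhp.
by exists J, S; split=> //; exact: half_plane_bound Jhp.
Qed.

Lemma rk_solution_exists_unique (tau : R) (f : R -> X) : 0 < tau ->
  exists! w : rk_trajectory X s, rk_solution D A Q b c tau f w.
Proof.
have [K0 [K [_ _ HT]]] := discretization => /HT [J [S [J1 J2 J3 _ [S1 S2 _ _]]]].
pose F n (i : 'I_s) := f (rk_node c tau n i).
pose stage n (u : X) i := J (S (mxact J (\adj (pencil Q))
  (fun j => u + tau%:C *: \sum_k (Q j k)%:C *: F n k) i)).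
pose incr n u i := A (stage n u i) + F n i.
pose u := fix u n := if n is n'.+1 then
  u n' + tau%:C *: \sum_(i < s) (b i 0)%:C *: incr n' (u n') i else 0.
exists (RKTrajectory u (fun n => stage n (u n)) (fun n => incr n (u n))); split.
  split=> // n; split=> //; first by move=> i; exact: J1.
  by move=> i; exact: (stage_existence J2 S1 S2 (u n) (F n)).
case=> u' U' dU' [u'0 sol].
have stageE n i : U' n i = stage n (u' n) i.
  have [DU eU _ edU] := sol n.
  rewrite /stage -(stage_uniqueness J2 J3 S2 (U := U' n)) ?J3// => j.
  rewrite {1}eU; congr (_ + _ *: _); apply: eq_bigr => k _.
  by rewrite edU.
have incrE n i : dU' n i = incr n (u' n) i.
  by have [_ _ _ ->] := sol n; rewrite /incr -stageE.
have uE n : u' n = u n.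
  elim: n => [|n IH] //=; have [_ _ -> _] := sol n; rewrite IH.
  by congr (_ + _ *: _); apply: eq_bigr => i _; rewrite incrE IH.
congr RKTrajectory.
- by apply/funext => n; rewrite uE.
- by apply/funext => n; apply/funext => i; rewrite stageE uE.
- by apply/funext => n; apply/funext => i; rewrite incrE uE.
Qed.

(** In the variation of constants formula the [tau] in front of the source cancels that of
    [tau A J = - act J (lin 0)], and Ritt's estimate bounds the k-th term by a multiple of
    [phi k / (n - k)]. *)
Lemma rk_pointwise_bound : exists2 K : R, 0 <= K &
  forall (tau : R) (f : R -> X) (w : rk_trajectory X s) (phi : nat -> R),
  0 < tau -> rk_solution D A Q b c tau f w ->
  (forall n i, normR (f (rk_node c tau n i)) <= phi n) ->
  forall n, [/\ D (rk_val w n),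
    normR (A (rk_val w n)) <= K * \sum_(k < n) phi k / (n - k)%:R &
    forall i, normR (A (rk_stage w n i)) <= K * (normR (A (rk_val w n)) + phi n)].
Proof.
have s0 : (0 < s)%N.
  rewrite lt0n; apply/eqP => s0; move: sum_b; rewrite big1 => [/eqP|i _].
    by rewrite eq_sym oner_eq0.
  by case: i => i hi; exfalso; rewrite s0 in hi.
have [K0 [K [K00 K_ge0 HT]]] := discretization.
set G := mxact_norm K0 source_row.
have G0 : 0 <= G by exact: mxact_norm_ge0.
set E := mxact_norm K0 (\adj (pencil Q)).
have E0 : 0 <= E by exact: mxact_norm_ge0.
set q := mxact_norm K0 (polyQ Q).
have q0 : 0 <= q by exact: mxact_norm_ge0.
pose K1 := K * (K * G); pose K2 := K * (E * (K0 + q * (1 + K0))).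
have K10 : 0 <= K1 by rewrite !mulr_ge0.
have K20 : 0 <= K2 by rewrite !(mulr_ge0, addr_ge0).
exists (K1 + K2) => [|tau f [u U dU] phi tau0 [u0 sol] fphi n]; first by rewrite addr_ge0.
have phi0 k : 0 <= phi k by apply: le_trans (fphi k (Ordinal s0)); exact: normR_ge0.
have [J [S [J1 J2 J3 JK [S1 S2 SK ritt]]]] := HT tau tau0.
have t0 : tau%:C != 0 :> C by rewrite fmorph_eq0 gt_eqF.
pose F n (i : 'I_s) := f (rk_node c tau n i).
pose V n i := U n i - tau%:C *: A (U n i).
have JV m i : J (V m i) = U m i by apply: J3; have [] := sol m.
pose bp : 'rV[{poly C}]_s := map_mx polyC (map_mx (real_complex R) (b^T *m invmx Q)).
(* The recursion for [(1 - tau A) u_n]; [u_n = J y_n] then also shows that [u_n] lies in the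
   domain. *)
pose y := fix y n := if n is n'.+1 then
  y n' + mxact J bp (fun j => V n' j - y n') 0 else 0.
have uJ m : u m = J (y m).
  elim: m => [|m IH]; first by rewrite u0 linear0.
  have [_ eU -> _] := sol m.
  rewrite /= linearD /= -IH; congr (_ + _).
  have bQ k : \sum_j (b^T *m invmx Q) 0 j * Q j k = b k 0.
    have := mulmxKV Q_inv b^T => /matrixP /(_ 0 k).
    by rewrite mxE => ->; rewrite mxE.
  rewrite -[J _](actX J) act_mxact mxact_constmx.
  symmetry; transitivity (\sum_j \sum_k (tau%:C * ((b^T *m invmx Q) 0 j * Q j k)%:C) *: dU m k).
    apply: eq_bigr => j _; rewrite actX linearB /= JV -IH {1}eU addrC addKr [in LHS]mxE.
    rewrite !scaler_sumr; apply: eq_bigr => k _.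
    by rewrite !scalerA rmorphM /= mulrCA mulrA.
  rewrite exchange_big scaler_sumr; apply: eq_bigr => k _.
  by rewrite -scaler_suml -mulr_sumr -rmorph_sum bQ scalerA.
have VE m i : V m i = S (mxact J (\adj (pencil Q))
    (fun j => J (y m) + tau%:C *: \sum_k (Q j k)%:C *: F m k) i).
  rewrite -uJ; have [DU eU _ edU] := sol m.
  apply: (stage_uniqueness J2 J3 S2 DU) => j.
  by rewrite {1}eU; congr (_ + _ *: _); apply: eq_bigr => k _; rewrite edU.
pose g m := S (mxact J source_row (F m) 0).
have yS m : y m.+1 = (S \o act J (pencil_num Q b)) (y m) + tau%:C *: g m.
  exact: (pencil_den_step S1 S2 Q_inv (VE m)).
have TE x : (S \o act J (pencil_num Q b)) x = (act J (pencil_num Q b) \o S) x.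
  by rewrite /= (inverse_act S1 S2).
have yE m : y m = tau%:C *: \sum_(k < m) iter (m.-1 - k) (act J (pencil_num Q b) \o S) (g k).
  elim: m => [|m IH]; first by rewrite big_ord0 scaler0.
  rewrite yS TE big_ord_recr /= subnn scalerDr; congr (_ + _).
  rewrite /= IH linearZ /= linearZ /=; congr (_ *: _); rewrite linear_sum /= linear_sum /=.
  apply: eq_bigr => k _; have km := ltn_ord k.
  by rewrite (subn_predS km).
have gK m : normR (g m) <= K * G * phi m.
  apply: le_trans (SK _) _; rewrite -mulrA ler_wpM2l//.
  by apply: normR_mxact => // j; exact: fphi.
have AuE m : A (u m) = - \sum_(k < m) act J (lin 0)
    (iter (m.-1 - k) (act J (pencil_num Q b) \o S) (g k)).
  apply: (scalerI t0); rewrite uJ -[LHS]opprK -(act_lin0 J2) yE linearZ /= scalerN.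
  by congr (- (_ *: _)); rewrite linear_sum.
have Au m : normR (A (u m)) <= K1 * \sum_(k < m) phi k / (m - k)%:R.
  rewrite AuE normRN; apply: le_trans (normR_sum _ _ _) _.
  rewrite mulr_sumr; apply: ler_sum => k _; have km := ltn_ord k.
  rewrite (subn_predS km) mulrA ler_pdivlMr ?ltr0n// mulrC; apply: le_trans (ritt _ _) _.
  by rewrite /K1 -[leRHS]mulrA ler_wpM2l.
have sum0 m : 0 <= \sum_(k < m) phi k / (m - k)%:R.
  by apply: sumr_ge0 => k _; rewrite mulr_ge0.
split=> /=; first by rewrite uJ.
  by apply: le_trans (Au n) _; rewrite ler_wpM2r// lerDl.
move=> i; apply: le_trans (_ : K2 * (normR (A (u n)) + phi n) <= _); last first.
  by rewrite ler_wpM2r ?addr_ge0 ?normR_ge0// lerDr.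
(* [act J (lin 0)] commutes with [S] and the adjugate. On [J y_n] it produces [- tau J A u_n], on
   [tau Q F] it acts as a bounded map, so [tau] cancels throughout. *)
pose H j := - J (A (u n)) + mxact J (polyQ Q) (fun k => act J (lin 0) (F n k)) j.
have AUE : A (U n i) = - S (mxact J (\adj (pencil Q)) H i).
  apply: (scalerI t0); rewrite -JV -[LHS]opprK -(act_lin0 J2) VE scalerN; congr (- _).
  rewrite -(inverse_act S1 S2) act_mxact -linearZ /= -mxactZ.
  congr (S (mxact J _ _ i)); apply/funext => j.
  rewrite /H scalerDr linearD linearZ /=; congr (_ + _ *: _).
    by rewrite -[J (y n)](actX J) act_comm actX (act_lin0 J2) -uJ linearN linearZ scalerN.
  rewrite mxact_constmx linear_sum; apply: eq_bigr => k _.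
  by rewrite linearZ mxE.
rewrite AUE normRN; apply: le_trans (SK _) _.
rewrite /K2 -mulrA ler_wpM2l// -mulrA; apply: normR_mxact => // j.
apply: le_trans (normRD _ _) _; rewrite normRN.
have l0 x : normR (act J (lin 0) x) <= (1 + K0) * normR x.
  rewrite act_lin subr0 scale1r mulrDl mul1r; apply: le_trans (normRB _ _) _.
  by rewrite lerD2l.
have m1 : normR (mxact J (polyQ Q) (fun k => act J (lin 0) (F n k)) j) <= q * ((1 + K0) * phi n).
  apply: normR_mxact => // k; apply: le_trans (l0 _) _.
  by rewrite ler_wpM2l ?addr_ge0//; exact: fphi.
have m2 := JK (A (u n)).
have a0 := normR_ge0 (A (u n)).
have p0 := phi0 n.
have x1 : 0 <= K0 * phi n by rewrite mulr_ge0.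
have x2 : 0 <= q * (1 + K0) * normR (A (u n)) by rewrite !(mulr_ge0, addr_ge0).
by lra.
Qed.

End Trajectory.
End RungeKutta.

(** * Schur's test and the harmonic kernel *)

Section SchurTest.
Variable R : realType.

(** Young's inequality for [r] and [r / (r - 1)]; the case [r = 1] is an equality, treated apart. *)
Lemma powR_tangent (r t m : R) : 1 <= r -> 0 <= t -> 0 <= m ->
  t * m `^ (r - 1) <= t `^ r / r + m `^ r * (1 - r^-1).
Proof.
rewrite le_eqVlt => /orP[/eqP<-|r1] t0 m0.
  by rewrite subrr powRr0 mulr1 powRr1// invr1 subrr mulr0 addr0 mulr1.
have rp : 0 < r by rewrite (lt_trans ltr01).
have q1 : 0 < r - 1 by rewrite subr_gt0.
have -> : m `^ r * (1 - r^-1) = (m `^ (r - 1)) `^ (r / (r - 1)) / (r / (r - 1)).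
  rewrite -powRrM mulrCA mulfV ?gt_eqF// mulr1; congr (_ * _).
  by field; rewrite !gt_eqF.
apply: conjugate_powR; rewrite ?powR_ge0 ?divr_gt0//.
by field; rewrite !gt_eqF.
Qed.

(** The tangent inequality at the mean [m = x / W] is summed with the weights [k]. Their total is at
    most [W], so the constant term is absorbed on the left, leaving [W m^r / r]. *)
Lemma weighted_jensen (N : nat) (r W x : R) (k y : 'I_N -> R) : 1 <= r -> 0 < W ->
  (forall j, 0 <= k j) -> (forall j, 0 <= y j) -> \sum_j k j <= W ->
  0 <= x <= \sum_j k j * y j -> x `^ r <= W `^ (r - 1) * \sum_j k j * y j `^ r.
Proof.
move=> r1 W0 k0 y0 kW /andP[x0 xle].
have rp : 0 < r by rewrite (lt_le_trans ltr01).
pose m := x / W; have m0 : 0 <= m by rewrite divr_ge0// ltW.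
have eW : W * m = x by rewrite /m mulrC divfK// gt_eqF.
have mr : m * m `^ (r - 1) = m `^ r by exact: mulr_powRB1.
have mr0 : 0 <= m `^ r := powR_ge0 _ _.
have r1' : 0 <= 1 - r^-1 by rewrite subr_ge0 invf_le1.
have h : W * m `^ r <= \sum_j k j * (y j `^ r / r + m `^ r * (1 - r^-1)).
  rewrite (_ : W * m `^ r = x * m `^ (r - 1)); last by rewrite -mr mulrA eW.
  apply: le_trans (ler_wpM2r (powR_ge0 _ _) xle) _.
  rewrite mulr_suml; apply: ler_sum => j _; rewrite -mulrA ler_wpM2l//.
  exact: powR_tangent.
have {}h : W * m `^ r <= \sum_j k j * y j `^ r.
  move: h; under eq_bigr do rewrite mulrDr mulrA.
  rewrite big_split /= -!mulr_suml => h.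
  have h2 : (\sum_j k j) * (m `^ r * (1 - r^-1)) <= W * (m `^ r * (1 - r^-1)).
    by rewrite ler_wpM2r// mulr_ge0.
  have : W * m `^ r / r <= (\sum_j k j * y j `^ r) / r by lra.
  by rewrite ler_pM2r ?invr_gt0.
have -> : x `^ r = W `^ (r - 1) * (W * m `^ r).
  by rewrite mulrA [_ * W]mulrC mulr_powRB1 ?ltW// -powRM ?(ltW W0)// eW.
by rewrite ler_wpM2l ?powR_ge0.
Qed.

(** Row sums give [W^(r-1)] through Jensen, column sums one more [W] after exchanging the sums; for
    the maximum norm the rows alone suffice. *)
Lemma lp_norm_schur (Y Z : Type) (nY : Y -> R) (nZ : Z -> R) (p : \bar R) (N : nat)
    (v : nat -> Y) (w : nat -> Z) (a : nat -> nat -> R) (W : R) :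
  (1 <= p)%E -> 0 < W -> (forall n j, 0 <= a n j) ->
  (forall n, (n < N)%N -> \sum_(j < N) a n j <= W) ->
  (forall j, (j < N)%N -> \sum_(n < N) a n j <= W) ->
  (forall j, 0 <= nZ (w j)) ->
  (forall n, (n < N)%N -> 0 <= nY (v n) <= \sum_(j < N) a n j * nZ (w j)) ->
  lp_norm nY p N v <= W * lp_norm nZ p N w.
Proof.
move=> p1 W0 a0 row col z0 yz; case: p p1 => [r| |] // p1 /=.
  have r1 : 1 <= r by rewrite -lee_fin.
  have rp : 0 < r by rewrite (lt_le_trans ltr01).
  have sz : 0 <= \sum_(n < N) nZ (w n) `^ r by apply: sumr_ge0 => n _; exact: powR_ge0.
  have -> : W = (W `^ r) `^ r^-1 by rewrite -powRrM mulfV ?gt_eqF// powRr1// ltW.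
  rewrite -powRM ?powR_ge0//; apply: ge0_ler_powR; rewrite ?nnegrE ?invr_ge0 ?(ltW rp)//.
  - by apply: sumr_ge0 => n _; exact: powR_ge0.
  - by rewrite mulr_ge0// powR_ge0.
  apply: le_trans (_ : \sum_(n < N) W `^ (r - 1) * \sum_(j < N) a n j * nZ (w j) `^ r <= _).
    apply: ler_sum => n _; apply: weighted_jensen => //; first exact: row.
    exact: yz.
  rewrite -mulr_sumr exchange_big /= -[W `^ r](mulr_powRB1 (ltW W0) rp) -mulrA mulrCA.
  rewrite ler_wpM2l ?powR_ge0// mulr_sumr; apply: ler_sum => j _.
  by rewrite -mulr_suml ler_wpM2r ?powR_ge0// col.
set m := \big[Num.max/0]_(n < N) nZ (w n).
have m0 : 0 <= m by exact: bigmax_ge_id.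
apply: bigmax_le => [|n _]; first by rewrite mulr_ge0// ltW.
have /andP[_ h] := yz n (ltn_ord n); apply: le_trans h _.
apply: le_trans (ler_wpM2r m0 (row n (ltn_ord n))).
rewrite mulr_suml; apply: ler_sum => j _; rewrite ler_wpM2l//.
exact: (le_bigmax _ (fun j : 'I_N => nZ (w j))).
Qed.

Lemma lp_norm_ge0 (Y : Type) (nY : Y -> R) (p : \bar R) (N : nat) (v : nat -> Y) :
  0 <= lp_norm nY p N v.
Proof.
case: p => [r| |] //=; first exact: powR_ge0.
exact: bigmax_ge_id.
Qed.

Definition harmonic_kernel (n j : nat) : R := if (j <= n)%N then (n - j).+1%:R^-1 else 0.

Lemma harmonic_kernel_ge0 n j : 0 <= harmonic_kernel n j.
Proof. by rewrite /harmonic_kernel; case: ifP. Qed.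

(** Telescoping [1 / k <= - ln (1 - 1 / k) = ln k - ln (k - 1)]. *)
Lemma harmonic_le_ln (N : nat) : (0 < N)%N -> \sum_(k < N) k.+1%:R^-1 <= 1 + ln N%:R :> R.
Proof.
case: N => // N _; elim: N => [|N IH].
  by rewrite big_ord1 invr1 ln1 addr0.
rewrite big_ord_recr /=; apply: le_trans (lerD IH (lexx _)) _.
rewrite -addrA lerD2l -lerBrDl.
have n1 : 0 < N.+1%:R :> R by rewrite ltr0n.
have n2 : 0 < N.+2%:R :> R by rewrite ltr0n.
have e : N.+2%:R = N.+1%:R + 1 :> R by rewrite -natr1.
have -> : ln N.+2%:R - ln N.+1%:R = - ln (1 - N.+2%:R^-1) :> R.
  have -> : 1 - N.+2%:R^-1 = N.+1%:R / N.+2%:R :> R.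
    apply: (mulIf (lt0r_neq0 n2)).
    by rewrite mulrBl mul1r mulVf ?gt_eqF// divfK ?gt_eqF// e addrK.
  by rewrite ln_div ?posrE// opprB.
rewrite -lerN2 opprK; apply: le_ln1Dx; rewrite ltrN2 invf_lt1//.
by rewrite ltr1n.
Qed.

Lemma harmonic_sum_mono (m N : nat) : (m <= N)%N ->
  \sum_(k < m) k.+1%:R^-1 <= \sum_(k < N) k.+1%:R^-1 :> R.
Proof.
move=> mN; rewrite (big_ord_widen _ (fun k => k.+1%:R^-1) mN) big_mkcond.
by apply: ler_sum => k _; case: ifP.
Qed.

Lemma harmonic_kernel_row (N n : nat) (phi : nat -> R) : (n < N)%N ->
  \sum_(j < N) harmonic_kernel n j * phi j = \sum_(j < n.+1) phi j / (n.+1 - j)%:R.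
Proof.
move=> nN; rewrite (big_ord_widen _ (fun j => phi j / (n.+1 - j)%:R) nN) [RHS]big_mkcond.
apply: eq_bigr => j _; rewrite /harmonic_kernel ltnS; case: leqP => // jn.
  by rewrite subSn// mulrC.
by rewrite mul0r.
Qed.

Lemma harmonic_kernel_row_le (N n : nat) : (n < N)%N ->
  \sum_(j < N) harmonic_kernel n j <= 1 + ln N%:R.
Proof.
move=> nN; have := harmonic_kernel_row (fun=> 1) nN.
under eq_bigr do rewrite mulr1. move=> ->.
apply: le_trans (harmonic_le_ln (leq_ltn_trans (leq0n _) nN)).
apply: le_trans (harmonic_sum_mono nN).
rewrite (reindex_inj rev_ord_inj) /=; apply: ler_sum => j _.
by rewrite mul1r subKn.
Qed.

Lemma harmonic_kernel_col_le (N j : nat) : (j < N)%N ->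
  \sum_(n < N) harmonic_kernel n j <= 1 + ln N%:R.
Proof.
move=> jN; apply: le_trans (harmonic_le_ln (leq_ltn_trans (leq0n _) jN)).
rewrite -big_mkcond /= -(big_mkord (fun n => j <= n)%N (fun n => (n - j).+1%:R^-1)).
rewrite (_ : \sum_(_ <= _ < _ | _) _ = \sum_(j <= n < N) (n - j).+1%:R^-1); last first.
  by rewrite [RHS](big_nat_widenl _ 0%N)//.
rewrite -{1}[j]add0n big_addn big_mkord.
apply: le_trans (harmonic_sum_mono (leq_subr j N)).
by apply: ler_sum => i _; rewrite addnK.
Qed.

End SchurTest.

(* N = 1 is excluded: there log N = 0, while the left-hand side is not 0. *)
Theorem theorem7p4 (R : realType) (X : completeNormedModType R[i])
    (D : set X) (A : X -> X) (theta : R)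
    (s : nat) (Q : 'M[R]_s) (b c : 'cV[R]_s) (nu : ('I_s -> X) -> R)
    (A_gen : generates_analytic_semigroup D A)
    (theta_gt : pi / 2 < theta)
    (A_sect : uniformly_sectorial D A theta)
    (rk_order : rk_order_ge Q b c 1)
    (rk_stable : A_stable Q b)
    (Q_inv : Q \in unitmx)
    (R_infty : `|stability_infty Q b| < 1)
    (nu_norm : product_norm nu) :
  (forall (tau : R) (f : R -> X), 0 < tau ->
     exists! w : rk_trajectory X s, rk_solution D A Q b c tau f w) /\
  exists C : R,
    forall (N : nat) (tau : R) (p : \bar R) (f : R -> X) (w : rk_trajectory X s),
      (1 < N)%N -> 0 < tau -> (1 <= p)%E ->
      rk_solution D A Q b c tau f w ->
      (forall n, D (rk_val w n.+1)) /\
      lp_norm (@normR R X) p N (fun n => A (rk_val w n.+1))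
        + lp_norm nu p N (fun n i => A (rk_stage w n i))
      <= C * ln N%:R * lp_norm nu p N (fun n i => f (rk_node c tau n i)).
Proof.
have sum_b := order1_sum_weights rk_order.
split=> [tau f tau0|].
  exact: (rk_solution_exists_unique c theta_gt A_sect rk_stable Q_inv R_infty sum_b).
have [K K0 HK] := rk_pointwise_bound c theta_gt A_sect rk_stable Q_inv R_infty sum_b.
have [_ _ [m [M [m0 M0 mM]]]] := nu_norm.
have nu0 V : 0 <= nu V.
  have /andP[h _] := mM V; apply: le_trans h.
  by rewrite mulr_ge0 ?(ltW m0)//; exact: bigmax_ge_id.
(* The summands 1 make both constants positive, as the Schur test asks. *)
pose C1 := K / m + 1; pose C2 := M * (K * (2 * K + 1)) / m + 1.
have C10 : 0 < C1 by rewrite ltr_wpDl// divr_ge0// ltW.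
have C20 : 0 < C2.
  by rewrite ltr_wpDl// divr_ge0 ?(ltW m0)// mulr_ge0 ?(ltW M0)// mulr_ge0//; lra.
have ln2 : 0 < ln 2 :> R by rewrite ln_gt0// ltr1n.
(* For [N >= 2] one has [1 + ln N <= (1 + 1 / ln 2) ln N]. *)
exists ((C1 + C2) * (1 + (ln 2)^-1)) => N tau p f w N1 tau0 p1 sol.
pose F n (i : 'I_s) := f (rk_node c tau n i).
pose phi n := nu (F n) / m.
have phi0 n : 0 <= phi n by rewrite divr_ge0// ltW.
have Fphi n i : normR (f (rk_node c tau n i)) <= phi n.
  rewrite /phi ler_pdivlMr// mulrC; have /andP[h _] := mM (F n); apply: le_trans h.
  by rewrite ler_wpM2l ?(ltW m0)//; exact: (le_bigmax _ (fun i => normR (F n i))).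
have B := HK tau f w phi tau0 sol Fphi.
split=> [n|]; first by have [] := B n.+1.
pose L : R := 1 + ln N%:R.
have NR : 1 < N%:R :> R by rewrite ltr1n.
have L0 : 0 < L by rewrite addr_gt0// ln_gt0.
pose h := @harmonic_kernel R.
have schur (Y : Type) (nY : Y -> R) (v : nat -> Y) (C : R) : 0 < C ->
    (forall n, (n < N)%N -> 0 <= nY (v n) <= C * m * \sum_(j < N) h n j * phi j) ->
    lp_norm nY p N v <= C * L * lp_norm nu p N F.
  move=> C0 bnd; apply: (@lp_norm_schur _ _ _ _ _ _ _ _ _ (fun n j => C * h n j)) => //.
  - by rewrite mulr_gt0.
  - by move=> n j; rewrite mulr_ge0 ?(ltW C0)// harmonic_kernel_ge0.
  - by move=> n nN; rewrite -mulr_sumr ler_wpM2l ?(ltW C0)// harmonic_kernel_row_le.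
  - by move=> n nN; rewrite -mulr_sumr ler_wpM2l ?(ltW C0)// harmonic_kernel_col_le.
  move=> n nN; have /andP[-> bn] := bnd n nN; apply: le_trans bn _.
  rewrite -mulrA mulr_sumr mulr_sumr le_eqVlt; apply/orP; left; apply/eqP.
  by apply: eq_bigr => j _; rewrite /phi; field; rewrite gt_eqF.
have hs0 n : 0 <= \sum_(j < N) h n j * phi j.
  by apply: sumr_ge0 => j _; rewrite mulr_ge0 ?harmonic_kernel_ge0.
have b1 : lp_norm (@normR R X) p N (fun n => A (rk_val w n.+1)) <= C1 * L * lp_norm nu p N F.
  apply: schur => // n nN; have := hs0 n; rewrite normR_ge0 /= harmonic_kernel_row// => hs.
  have [_ h1 _] := B n.+1; apply: le_trans h1 _.
  by rewrite ler_wpM2r// /C1 mulrDl divfK ?gt_eqF// mul1r lerDl ltW.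
have b2 : lp_norm nu p N (fun n i => A (rk_stage w n i)) <= C2 * L * lp_norm nu p N F.
  apply: schur => // n nN; rewrite nu0 /=.
  have /andP[_ h1] := mM (fun i => A (rk_stage w n i)); apply: le_trans h1 _.
  pose H := \sum_(j < N) h n j * phi j.
  have HE : H = \sum_(j < n) phi j / (n.+1 - j)%:R + phi n.
    by rewrite /H harmonic_kernel_row// big_ord_recr /= subSnn invr1 mulr1.
  have [_ hA hU] := B n.
  (* [n + 1 - j <= 2 (n - j)] for [j < n] passes from the kernel of [A u_n] to row [n] of the
     harmonic kernel, whose diagonal term is the remaining [phi n]. *)
  have prev : \sum_(j < n) phi j / (n - j)%:R <= 2 * \sum_(j < n) phi j / (n.+1 - j)%:R.
    rewrite mulr_sumr; apply: ler_sum => j _; have jn := ltn_ord j.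
    rewrite mulrCA ler_wpM2l// subSn ?(ltnW jn)//.
    have k0 : 0 < (n - j)%:R :> R by rewrite ltr0n subn_gt0.
    rewrite -div1r ler_pdivrMr// mulrAC ler_pdivlMr ?ltr0n// mul1r -natr1.
    have : 1 <= (n - j)%:R :> R by rewrite ler1n subn_gt0.
    by lra.
  have tail0 : 0 <= \sum_(j < n) phi j / (n.+1 - j)%:R.
    by apply: sumr_ge0 => j _; rewrite divr_ge0.
  have KA : normR (A (rk_val w n)) + phi n <= (2 * K + 1) * H.
    apply: le_trans (lerD (le_trans hA (ler_wpM2l K0 prev)) (lexx _)) _.
    have : 0 <= K * phi n by rewrite mulr_ge0.
    by rewrite HE; nra.
  have KU i : normR (A (rk_stage w n i)) <= K * (2 * K + 1) * H.
    by apply: le_trans (hU i) _; rewrite -mulrA ler_wpM2l.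
  apply: le_trans (_ : M * (K * (2 * K + 1) * H) <= _).
    rewrite ler_wpM2l ?(ltW M0)//; apply: bigmax_le => //.
    by rewrite mulr_ge0 ?hs0// mulr_ge0//; lra.
  have C2m : M * (K * (2 * K + 1)) <= C2 * m.
    by rewrite /C2 [leRHS]mulrDl divfK ?gt_eqF// mul1r lerDl ltW.
  by rewrite mulrA ler_wpM2r ?hs0.
apply: le_trans (lerD b1 b2) _.
rewrite -mulrDl ler_wpM2r ?lp_norm_ge0//.
rewrite -mulrDl -mulrA ler_wpM2l//; first exact: ltW (addr_gt0 C10 C20).
rewrite /L mulrDl mul1r addrC lerD2l mulrC ler_pdivlMr// mul1r.
by rewrite ler_ln ?posrE ?ler_nat// ltr0n (ltn_trans _ N1).
Qed.
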